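(* Suppose, in the tuple $K=(k_1,\ldots,k_s)$ of positive integers, the largest number is $l$, and there are $b_i$ of $i$'s; put $d'=\sum_ik_i$. Let $\beta=(\beta_1,\ldots,\beta_n)\vdash d$. Then $$H_{d,d}(K;(d),\beta)=\frac{d^{d'-1}}{Aut(\beta)}\prod_{i=1}^l\frac{b_i!}{(i!)^{b_i}}\sum_{t\ge0}[t_1^{b_1}\cdots t_l^{b_l}z^ty^t]\ \frac{t!}{d^t}\,\mathcal{U}(t_1,\ldots,t_l;z)\;e^{-dy/2}\,y^{n-1}\sum_\lambda\frac{\xi_{2\lambda}S_{2\lambda}}{|Aut(\lambda)|}\Big(\frac y2\Big)^{2|\lambda|},$$ where the inner sum runs over partitions $\lambda$.
   Context: $[\,\cdot\,]$ in front of an expression denotes coefficient extraction. $\mathcal{U}(t_1,\ldots,t_l;z)=\exp\big(\sum_{i=1}^l\{(1+z)^i-z^i\}t_i\big)$. For $j>0$: $\xi_{2j}=[x^{2j}]\log(\sinh x/x)$ and $S_{2j}=-1+\sum_{k=1}^n\beta_k^{2j}$; for a partition $\lambda=(\lambda_1,\lambda_2,\ldots)$, $\xi_{2\lambda}=\prod_i\xi_{2\lambda_i}$ and $S_{2\lambda}=\prod_iS_{2\lambda_i}$. $Aut(\lambda)=|Aut(\lambda)|=\prod_im_i!$ for $\lambda=[1^{m_1},2^{m_2},\ldots]$ (that is, $m_i$ parts equal to $i$). $\mathcal{C}_\lambda$ is the conjugacy class of cycle type $\lambda$ in the symmetric group $\mathfrak{S}_{|\lambda|}$, $\chi^\lambda$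 the irreducible character indexed by $\lambda$, $\chi^\lambda_\mu$ its value on $\mathcal{C}_\mu$, $\dim(\lambda)$ its degree, $\ell(\lambda)$ the number of parts of $\lambda$. For $k\ge1$ let $p_k(\lambda)=\sum_{i\ge1}\big[(\lambda_i-i+\tfrac12)^k-(-i+\tfrac12)^k\big]$. Let $f_\eta(\mu)=\binom{|\mu|}{|\eta|}|\mathcal{C}_\eta|\chi^\mu_\eta/\dim(\mu)$, where $f_\eta(\mu)=0$ if $|\mu|<|\eta|$, where for $|\mu|>|\eta|$ the value $\chi^\mu_\eta$ is taken at an element of cycle type $\eta$ of the subgroup $\mathfrak{S}_{|\eta|}$ of $\mathfrak{S}_{|\mu|}$, and $f_\varnothing=1$. The $f_\eta$ form a basis of the algebra of shifted symmetric functions; write $p_k=\sum_\eta\kappa_{k,\eta}f_\eta$. For $|\eta|\le d$ let $\eta^{\uparrow d}\vdash d$ be $\eta$ with $d-|\eta|$ parts equal to 1 added. For $\mu^1,\ldots,\mu^r\vdash d$, $$H_d(k_1,\ldots,k_s;\mu^1,\ldots,\mu^r)=\frac1{d!}\sum_{\eta_1,\ldots,\eta_s,\ |\eta_i|\le d}\ \Big(\prod_{i=1}^s\frac{\kappa_{k_i,\eta_i}}{k_i!}\Big)N,$$ where the $\eta_i$ are partitions and $N$ is the number of tuples $(\sigma_1,\ldots,\sigma_s,\pi_1,\ldots,\pi_r)$ in $\mathfrak{S}_d$ with $\sigma_1\cdots\sigma_s\pi_1\cdots\pi_r=1$, $\sigma_i$ of cycle type $\eta_i^{\uparrow d}$,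 $\pi_j$ of cycle type $\mu^j$. Finally, for $K=(k_1,\ldots,k_s)$, $H_{d,m}(K;\mu^1,\ldots,\mu^r)=\sum_{\mu^{r+1}\vdash d,\ \ell(\mu^{r+1})=m}H_d(k_1,\ldots,k_s;\mu^1,\ldots,\mu^{r+1})$.
   Formalization: In the definition of H_d each summand is multiplied by the product over i of binom(m_1(η_i^{↑d}), m_1(η_i)), where m_1 counts parts equal to 1; without this factor the formula fails, e.g. for K=(1), d=2, β=(2), where the left side is 1/2 and the right side is 1. *)

(* Defs.v *)
From mathcomp Require Import all_boot all_order all_algebra all_fingroup.
From mathcomp Require Import all_solvable all_field all_character.
From mathcomp Require Import mpoly.

Set Implicit Arguments.
Unset Strict Implicit.
Unset Printing Implicit Defensive.

Import GRing.Theory Num.Theory.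

Local Open Scope ring_scope.

(* Rational quantities live in algC, where characters take their values. *)

(** * Integer partitions *)

(* Weakly decreasing sequences of positive integers; [::] is the empty
   partition, sumn la is |la| and size la is the number of parts. *)
Definition is_partition (la : seq nat) : bool :=
  sorted geq la && (0%N \notin la).

(* A finType, so that sums over partitions can be written: a partition of size
   at most d has at most d parts, each at most d. *)
Definition partition_le (d : nat) : predArgType :=
  {s : d.-bseq 'I_d.+1 |
    is_partition (map val s) && (sumn (map val s) <= d)%N}.

Definition parts (d : nat) (x : partition_le d) : seq nat :=
  map val (val x : d.-bseq 'I_d.+1).

Coercion parts : partition_le >-> seq.

Lemma parts_inj d : injective (@parts d).
Proof. by move=> x y /(inj_map val_inj) /val_inj /val_inj. Qed.

Lemma codom_parts d la :
  (la \in codom (@parts d)) = is_partition la && (sumn la <= d)%N.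
Proof.
apply/codomP/idP => [[x ->] | /andP[la_part la_le]]; first exact: valP x.
have sz_le (s : seq nat) : 0%N \notin s -> (size s <= sumn s)%N.
  elim: s => //= a s IHs; rewrite inE negb_or => /andP[a_neq0 /IHs].
  by rewrite -add1n; apply: leq_add; rewrite lt0n eq_sym.
have el_le (s : seq nat) a : a \in s -> (a <= sumn s)%N.
  elim: s => //= b s IHs; rewrite inE => /predU1P[-> | /IHs]; first exact: leq_addr.
  by move/leq_trans; apply; apply: leq_addl.
pose t := [seq (inord a : 'I_d.+1) | a <- la].
have tE : map val t = la.
  rewrite -map_comp -[RHS]map_id; apply/eq_in_map => a /el_le a_le /=.
  by rewrite inordK // ltnS (leq_trans a_le).
have t_le : (size t <= d)%N.
  by rewrite size_map (leq_trans _ la_le) // sz_le //; case/andP: la_part.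
have tP : is_partition (map val (Bseq t_le)) && (sumn (map val (Bseq t_le)) <= d)%N.
  by rewrite /= tE la_part.
by exists (Sub (Bseq t_le) tP); rewrite /parts SubK /= tE.
Qed.

Definition conj_part (la : seq nat) : seq nat :=
  [seq count (fun x => (i < x)%N) la | i <- iota 0 (head 0%N la)].

(* The order of the automorphism group: \prod_i m_i!. *)
Definition aut_part (la : seq nat) : nat :=
  \prod_(i <- undup la) (count_mem i la)`!.

(** * Cycle types and irreducible characters of the symmetric groups *)

Definition cycle_type (d : nat) (s : 'S_d) : seq nat :=
  sort geq [seq #|c| | c : {set 'I_d} <- enum (porbits s)].

Definition conj_class (d : nat) (la : seq nat) : {set 'S_d} :=
  [set s | cycle_type s == la].

(* eta with parts 1 added up to size d. *)
Definition up_part (d : nat) (eta : seq nat) : seq nat :=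
  eta ++ nseq (d - sumn eta) 1%N.

(* The Young subgroup of la in 'S_d, d = |la|: the permutations preserving the
   consecutive blocks of lengths la_1, la_2, ...; reshape_index la i is the
   index of the block that contains i. *)
Definition young_set (d : nat) (la : seq nat) : {set 'S_d} :=
  [set s : 'S_d |
    [forall i, reshape_index la (s i : 'I_d) == reshape_index la i]].

Lemma young_group_set d la : group_set (young_set d la).
Proof.
apply/group_setP; split=> [|s t]; first by rewrite inE; apply/forallP=> i; rewrite perm1.
rewrite !inE => /forallP sP /forallP tP; apply/forallP => i.
by rewrite permM (eqP (tP _)) (eqP (sP _)).
Qed.

Canonical young (d : nat) (la : seq nat) : {group 'S_d} :=
  Group (young_group_set d la).

Lemma sign_class_fun d :
  is_class_fun <<[set: 'S_d]>>%g [ffun s : 'S_d => (-1) ^+ odd_perm s : algC].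
Proof.
rewrite genGid; apply: intro_class_fun => [s t _ _ | s]; last by rewrite inE.
by rewrite odd_permJ.
Qed.

Definition sign_char (d : nat) : 'CF([set: 'S_d]) := Cfun 0 (sign_class_fun d).

(* The standard labelling of the irreducible characters: chi^la is the only
   irreducible constituent common to the permutation character on the cosets
   of the Young subgroup of la and to the sign character induced from the Young
   subgroup of the conjugate of la.  In particular (d) labels the trivial
   character and (1^d) the sign. *)
Definition chi_index (d : nat) (la : seq nat) : Iirr [set: 'S_d] :=
  odflt 0 [pick i |
    (i \in irr_constt ('Ind[[set: 'S_d], young d la] 1)) &&
    (i \in irr_constt ('Ind[[set: 'S_d], young d (conj_part la)]
                         ('Res[young d (conj_part la)] (sign_char d))))].

Definition chi (la : seq nat) : 'CF([set: 'S_(sumn la)]) :=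
  'chi_(chi_index (sumn la) la).

(* chi^la at cycle type mu of size |la|, through any element of that type. *)
Definition chi_at (la mu : seq nat) : algC :=
  if [pick s | s \in conj_class (sumn la) mu] is Some s then chi la s else 0.

Definition chi_dim (la : seq nat) : algC := chi la 1%g.

(** * Shifted symmetric functions *)

(* The terms of p_k(la) beyond the last part of la vanish. *)
Definition p_shifted (k : nat) (la : seq nat) : algC :=
  \sum_(i < size la)
    (((nth 0%N la i)%:R - i.+1%:R + 2^-1) ^+ k - (- i.+1%:R + 2^-1) ^+ k).

(* An element of cycle type eta of 'S_|eta|, seen in 'S_|mu|, has cycle type
   up_part |mu| eta. *)
Definition f_shifted (eta mu : seq nat) : algC :=
  if eta == [::] then 1
  else if (sumn mu < sumn eta)%N then 0
  else 'C(sumn mu, sumn eta)%:R * #|conj_class (sumn eta) eta|%:R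
       * chi_at mu (up_part (sumn mu) eta) / chi_dim mu.

(* p_k = \sum_eta kappa_(k, eta) f_eta for all k > 0.  At la only the eta with
   |eta| <= |la| contribute, since f_eta(la) = 0 otherwise.  These equations
   determine kappa_(k, eta) by induction on |eta|. *)
Definition p_expansion (kappa : nat -> seq nat -> algC) : Prop :=
  forall k : nat, (0 < k)%N -> forall la : seq nat, is_partition la ->
    p_shifted k la =
      \sum_(eta : partition_le (sumn la)) kappa k eta * f_shifted eta la.

(** * Hurwitz numbers with completed cycles *)

(* Tuples of permutations of given cycle types nus with product 1. *)
Definition num_factorizations (d : nat) (nus : seq (seq nat)) : nat :=
  #|[set x : (size nus).-tuple 'S_d |
      ((\prod_(s <- x) s)%g == 1%g) && (map (@cycle_type d) x == nus)]|.

(* The factor 'C(m_1(up_part d eta), m_1(eta)) counts, for a permutation of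
   cycle type up_part d eta, the sets of |eta| points off which it is the
   identity and on which it has cycle type eta.  It is the normalization of
   completed cycles under which f_eta(la) is the value on chi^la of the
   contribution of eta:
     'C(d, |eta|) |C_eta| = 'C(m_1(up_part d eta), m_1(eta)) |C_(up_part d eta)|.
   It is 1 when |eta| = d or eta has no part 1, but not in general: p_1 = f_(1)
   takes the value d on partitions of d, while up_part d [:: 1] is the type of
   the identity only. *)
Definition up_mult (d : nat) (eta : seq nat) : nat :=
  'C(count_mem 1%N (up_part d eta), count_mem 1%N eta).

Definition hurwitz (kappa : nat -> seq nat -> algC) (d : nat)
    (K : seq nat) (mus : seq (seq nat)) : algC :=
  (d`!%:R)^-1 *
  \sum_(eta : (size K).-tuple (partition_le d))
    (\prod_(i < size K)
       (kappa (nth 0%N K i) (tnth eta i) / (nth 0%N K i)`!%:R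
        * (up_mult d (tnth eta i))%:R)) *
    (num_factorizations d
       ([seq up_part d (parts e) | e <- eta] ++ mus))%:R.

Definition hurwitz_m (kappa : nat -> seq nat -> algC) (d m : nat)
    (K : seq nat) (mus : seq (seq nat)) : algC :=
  \sum_(nu : partition_le d | (sumn nu == d) && (size nu == m))
    hurwitz kappa d K (rcons mus nu).

(** * Formal power series in n variables over algC *)

(* A series is the family of its coefficients. *)
Definition fps (n : nat) : Type := 'X_{1..n} -> algC.

Definition fps_poly (n : nat) (p : {mpoly algC[n]}) : fps n := fun m => p@_m.

Definition fps_mul (n : nat) (a b : fps n) : fps n := fun m =>
  \sum_(k : 'X_{1..n < (mdeg m).+1, (mdeg m).+1} | m == (k.1 + k.2)%MM)
    a k.1 * b k.2.

Definition fps_pow (n : nat) (a : fps n) (k : nat) : fps n :=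
  iter k (fps_mul a) (fps_poly 1).

(* exp a, for a with zero constant term: a^k has no term of degree < k, so the
   coefficient of a monomial of degree N only involves the k <= N. *)
Definition fps_exp (n : nat) (a : fps n) : fps n := fun m =>
  \sum_(k < (mdeg m).+1) fps_pow a k m / k`!%:R.

(* log a, for a with constant term 1, as the series of log (1 + (a - 1)). *)
Definition fps_log (n : nat) (a : fps n) : fps n := fun m =>
  \sum_(1 <= k < (mdeg m).+1)
    (-1) ^+ k.+1 / k%:R * fps_pow (fun m' => a m' - fps_poly 1 m') k m.

(** * The right-hand side *)

(* [x^i] sinh x *)
Definition sinh_coef (i : nat) : algC := if odd i then (i`!%:R)^-1 else 0.

Definition sinhx_over_x : fps 1 := fun m => sinh_coef (m ord0).+1.

(* xi j is the number written xi_(2j), and S_num beta j is S_(2j). *)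
Definition xi (j : nat) : algC := fps_log sinhx_over_x (U_(ord0) *+ (2 * j))%MM.

Definition S_num (beta : seq nat) (j : nat) : algC :=
  -1 + \sum_(b <- beta) b%:R ^+ (2 * j).

Definition xi_part (la : seq nat) : algC := \prod_(j <- la) xi j.

Definition S_part (beta la : seq nat) : algC := \prod_(j <- la) S_num beta j.

(* The l + 2 variables are t_1, ..., t_l, z, y; tvar i stands for t_(i+1). *)
Definition tvar (l : nat) (i : 'I_l) : 'I_(l + 2) := lshift 2 i.
Definition zvar (l : nat) : 'I_(l + 2) := rshift l (ord0 : 'I_2).
Definition yvar (l : nat) : 'I_(l + 2) := rshift l (ord_max : 'I_2).

Definition U_series (l : nat) : fps (l + 2) :=
  fps_exp (fps_poly
    (\sum_(i < l) ((1 + 'X_(zvar l)) ^+ i.+1 - 'X_(zvar l) ^+ i.+1)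
                  * 'X_(tvar i))).
Arguments U_series : clear implicits.

(* The sum over all partitions la; only those with 2|la| <= deg m contribute to
   the coefficient of the monomial m. *)
Definition partition_series (l : nat) (beta : seq nat) : fps (l + 2) := fun m =>
  \sum_(la : partition_le (mdeg m))
    xi_part la * S_part beta la / (aut_part la)%:R
    * ((2^-1 *: 'X_(yvar l)) ^+ (2 * sumn la))@_m.
Arguments partition_series : clear implicits.

Definition rhs_series (l d : nat) (beta : seq nat) : fps (l + 2) :=
  fps_mul
    (fps_mul
       (fps_mul (U_series l)
                (fps_exp (fps_poly (- (d%:R / 2) *: 'X_(yvar l)))))
       (fps_poly ('X_(yvar l) ^+ (size beta).-1)))
    (partition_series l beta).
Arguments rhs_series : clear implicits.

(* The exponent of t_1^(b 1) ... t_l^(b l) z^t y^t. *)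
Definition rhs_monomial (l : nat) (b : nat -> nat) (t : nat) : 'X_{1..(l + 2)} :=
  (\sum_(i < l) U_(tvar i) *+ b i.+1 + U_(zvar l) *+ t + U_(yvar l) *+ t)%MM.

(* v is the sum of the terms of u, all but finitely many of which are 0. *)
Definition has_finite_sum (u : nat -> algC) (v : algC) : Prop :=
  exists T : nat, forall M : nat, (T <= M)%N -> \sum_(t < M) u t = v.

(* Main.v *)
Require Import Defs.
From mathcomp Require Import all_boot all_order all_algebra all_fingroup.
From mathcomp Require Import all_solvable all_field all_character.
From mathcomp Require Import mpoly.
From mathcomp Require Import zify ring.

Set Implicit Arguments.
Unset Strict Implicit.
Unset Printing Implicit Defensive.

Import GRing.Theory Num.Theory.
Local Open Scope ring_scope.

(** The left-hand side is a sum over hooks.  By the character formula of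
    Frobenius (num_factorizationsE) a Hurwitz number is a sum over the
    irreducible characters chi of S_d of products of central characters, and
    the completed cycle of index k acts on chi^la by p_k(la) / k!
    (p_shifted_central).  The factor for the cycle type (d) is chi evaluated at
    a long cycle, which vanishes unless chi is one of the d hook characters
    chi_j, labelled by (d - j, 1^j) (irr_cycle_eq0).  There chi_j of a long
    cycle is (-1)^j, and p_k takes the value
    (d - j - 1/2)^k - (- j - 1/2)^k.  With the class sizes d! / z_la this gives
    (hurwitz_hook_sum)

      H = 1 / (d z_beta) sum_j a_j prod_k P_k(j) / k!,

    where P_k(j) is that value of p_k and a_j = (-1)^j chi_j(beta).

    The hook characters come from the exterior powers of the permutation
    module, that is from the characters induced by the sign of the action on
    the j-subsets.  Counting orbits of pairs of subsets gives their inner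
    products (ext_char_dot), so that their alternating sums are orthonormal
    virtual characters, hence irreducible.  Expanding a product over the cycles
    (ext_char_gen) gives sum_j a_j q^j = prod_i (1 - q^beta_i) / (1 - q).  That
    chi_j carries the label of its hook is an inner product of two induced
    characters that equals 1 (Ind_perm_on_dot, chi_index_hook).

    On the right-hand side, the sum over partitions is the exponential of
    sum_j xi_2j S_2j (y/2)^2j, which by the definition of xi and S is
    prod_i sinhc (beta_i y/2) / sinhc (y/2), with sinhc x = sinh x / x.  Writing
    the hyperbolic sines as exponentials, the factor in y becomes
    1 / prod_i beta_i times sum_j a_j exp (- (j + 1/2) y) (y_factorE).  The
    coefficient of t^b in U is the product of the ((1 + z)^i - z^i)^b_i / b_i!
    (mcoeff_U_exponent_pow).  Hence t!/d^t [y^t] has the effect of evaluating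
    this polynomial at z = - (j + 1/2) / d, where (1 + z)^i - z^i equals
    P_i(j) / d^i, and both sides agree term by term in j. *)

(** * Cycle types and sizes of conjugacy classes *)

(** The order of the centralizer of a permutation of cycle type la. *)
Definition z_part (la : seq nat) : nat := (aut_part la * \prod_(k <- la) k)%N.

Lemma aut_part_cons k la :
  aut_part (k :: la) = (aut_part la * (count_mem k la).+1)%N.
Proof.
have wide s : {subset la <= s} -> uniq s ->
    aut_part la = (\prod_(i <- s) (count_mem i la)`!)%N.
  move=> la_s us; rewrite /aut_part.
  rewrite [RHS](bigID (mem la)) /= [X in (_ * X)%N]big1 ?muln1; last first.
    by move=> i i_la; rewrite (count_memPn i_la).
  rewrite -[RHS]big_filter; apply: perm_big; apply: uniq_perm; rewrite ?undup_uniq ?filter_uniq //.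
  by move=> i; rewrite mem_undup mem_filter /=; case: (boolP (i \in la)) => // /la_s ->.
have ku : uniq (undup (k :: la)) by apply: undup_uniq.
have kk : k \in undup (k :: la) by rewrite mem_undup mem_head.
rewrite (wide (undup (k :: la))) // => [|i ila]; last by rewrite mem_undup inE ila orbT.
rewrite {1}/aut_part !(big_rem k kk) /= eqxx add1n factS.
rewrite (@eq_big_seq _ _ _ _ _ _ (fun i => (count_mem i la)`!)); first by rewrite -mulnA mulnC.
move=> i; rewrite mem_rem_uniq // inE => /andP[/negbTE ik _].
by rewrite eq_sym ik.
Qed.

Lemma perm_aut_part la mu : perm_eq la mu -> aut_part la = aut_part mu.
Proof.
move=> lamu; rewrite /aut_part; under eq_bigr do rewrite (seq.permP lamu).
exact/perm_big/perm_undup/perm_mem.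
Qed.

Lemma z_part_cons k la :
  z_part (k :: la) = (z_part la * (k * (count_mem k la).+1))%N.
Proof. by rewrite /z_part aut_part_cons big_cons; lia. Qed.

Lemma perm_z_part la mu : perm_eq la mu -> z_part la = z_part mu.
Proof. by move=> p; rewrite /z_part (perm_aut_part p) (perm_big _ p). Qed.

Lemma aut_part_gt0 la : (0 < aut_part la)%N.
Proof. by rewrite /aut_part big_seq; apply: prodn_cond_gt0 => i _; apply: fact_gt0. Qed.

Lemma z_part_gt0 la : 0%N \notin la -> (0 < z_part la)%N.
Proof.
move=> la0; rewrite muln_gt0 aut_part_gt0 big_seq; apply: prodn_cond_gt0 => i ila.
by rewrite lt0n; apply: contraNneq la0 => <-.
Qed.

Definition cycle_lengths (T : finType) (s : {perm T}) : seq nat :=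
  [seq #|c| | c : {set T} <- enum (porbits s)].

Lemma perm_cycle_type d (s : 'S_d) : perm_eq (cycle_type s) (cycle_lengths s).
Proof. by rewrite perm_sort. Qed.

Lemma cycle_lengths_gt0 (T : finType) (s : {perm T}) : 0%N \notin cycle_lengths s.
Proof.
apply/mapP => -[c]; rewrite mem_enum => /imsetP[x _ ->] /eqP.
by rewrite eq_sym (negbTE (card_porbit_neq0 _ _)).
Qed.

Lemma cycle_type_partition d (s : 'S_d) : is_partition (cycle_type s).
Proof.
rewrite /is_partition (perm_mem (perm_cycle_type s)) cycle_lengths_gt0 andbT.
by apply: sort_sorted => m n; rewrite /geq /= leq_total.
Qed.

Lemma sorted_geq_perm_eq s t :
  sorted geq s -> sorted geq t -> perm_eq s t -> s = t.
Proof. by apply: sorted_eq => [? ? ? /= *|m n]; [lia | rewrite /geq /=; lia]. Qed.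

Lemma cycle_typeE d (s : 'S_d) la : is_partition la ->
  (cycle_type s == la) = perm_eq (cycle_lengths s) la.
Proof.
move=> /andP[sla _]; apply/eqP/idP => [<-|p]; first by rewrite perm_sym perm_cycle_type.
apply: sorted_geq_perm_eq => //; first by case/andP: (cycle_type_partition s).
exact: perm_trans (perm_cycle_type s) p.
Qed.

Lemma perm_map_enum_setU1 (T : finType) (a : {set T}) (A : {set {set T}}) : a \notin A ->
  perm_eq [seq #|c| | c : {set T} <- enum (a |: A)] (#|a| :: [seq #|c| | c : {set T} <- enum A]).
Proof.
move=> aA; rewrite -(map_cons (fun c : {set T} => #|c|)); apply: perm_map.
apply: uniq_perm => /=; rewrite ?enum_uniq ?mem_enum ?aA // => c.
by rewrite mem_enum !inE mem_enum.
Qed.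

Lemma porbit_fix (T : finType) (s : {perm T}) x : s x = x -> porbit s x = [set x].
Proof.
move=> sx; apply/setP => y; rewrite inE; apply/porbitP/eqP => [[i ->]|->].
  exact: permX_fix.
by exists 0%N; rewrite expg0 perm1.
Qed.

Lemma porbit_closed (T : finType) (s : {perm T}) x y : (s y \in porbit s x) = (y \in porbit s x).
Proof.
by rewrite -!eq_porbit_mem; have /= <- := porbit_perm s 1 y; rewrite expg1.
Qed.

(** The powers of the product at y agree with those of s until the cycle of s
    closes; the last step then goes through the fixed point x. *)
Lemma porbits_insert (T : finType) (s : {perm T}) x y : s x = x -> x != y ->
  porbits (s * tperm x y)%g =
    (x |: porbit s y) |: (porbits s :\ [set x] :\ porbit s y).
Proof.
move=> sx xy; set t := (s * tperm x y)%g; set P := porbit s y.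
have tM z : t z = tperm x y (s z) by rewrite permM.
clearbody t.
have xP : x \notin P by rewrite porbit_sym (porbit_fix sx) inE eq_sym.
have tE z : z != x -> s z != y -> t z = s z.
  move=> zx szy; rewrite tM tpermD // 1?eq_sym //.
  by apply: contraNneq zx => xE; apply/eqP/(@perm_inj _ s); rewrite sx.
have out z : z \notin x |: P -> porbit t z = porbit s z.
  rewrite !inE negb_or => /andP[zx zP].
  have tX i : ((t ^+ i) z = (s ^+ i) z)%g.
    elim: i => [|i IH]; first by rewrite !expg0 !perm1.
    rewrite !expgSr !permM IH tE //.
    - apply: contraNneq zx => E; apply/eqP/(@perm_inj _ (s ^+ i)%g).
      by rewrite E permX_fix.
    - apply: contraNneq zP => zy; rewrite porbit_sym -zy porbit_closed.
      exact: mem_porbit.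
  apply/setP => w; apply/porbitP/porbitP => -[i ->]; exists i; by rewrite tX.
have tX i : (i < #|P|)%N -> ((t ^+ i) y = (s ^+ i) y)%g.
  elim: i => [|i IH] ilt; first by rewrite !expg0 !perm1.
  rewrite !expgSr !permM (IH (ltnW ilt)) tE //.
    apply: contraNneq xP => <-; exact: mem_porbit.
  apply/eqP => yE.
  have /(nth_uniq y) nU : uniq (traject s y #|P|) by apply: uniq_traject_porbit.
  have := nU 0%N i.+1; rewrite size_traject ilt (leq_ltn_trans _ ilt) // => /(_ isT isT).
  by rewrite !nth_traject ?(leq_ltn_trans _ ilt) //= -permX yE eqxx.
have k0 : (0 < #|P|)%N by rewrite lt0n card_porbit_neq0.
have tk : ((t ^+ #|P|) y = x)%g.
  have [m mE] : exists m, #|P| = m.+1 by exists #|P|.-1; rewrite prednK.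
  rewrite mE expgSr permM tX ?mE // tM -[s _]permM -expgSr -mE.
  by rewrite permX iter_porbit tpermR.
have sub : x |: P \subset porbit t y.
  apply/subsetP => z /setU1P[->|]; first by rewrite -tk mem_porbit.
  rewrite [z \in P]porbit_traject => /trajectP[i ilt ->].
  by rewrite -permX -tX // mem_porbit.
have closed z : (t z \in x |: P) = (z \in x |: P).
  have [->|zx] := eqVneq z x; first by rewrite tM sx tpermL !inE porbit_id eqxx orbT.
  have [sz|sz] := eqVneq (s z) y.
    by rewrite tM sz tpermR setU11 inE -[z \in P](porbit_closed s y z) sz porbit_id orbT.
  rewrite tE // !inE [s z \in P]porbit_closed; congr (_ || _).
  by rewrite -{1}sx (inj_eq (@perm_inj _ s)).
have yE : porbit t y = x |: P.
  apply/eqP; rewrite eqEsubset sub andbT; apply/subsetP => z /porbitP[i ->].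
  elim: i => [|i IH]; first by rewrite expg0 perm1 !inE porbit_id orbT.
  by rewrite expgSr permM closed.
have inn z : z \in x |: P -> porbit t z = x |: P.
  by rewrite -yE => zy; apply/eqP; rewrite eq_porbit_mem.
apply/setP => c; rewrite !inE; apply/imsetP/idP => [[z _ ->]|].
  have [zP|zP] := boolP (z \in x |: P); first by rewrite inn ?eqxx.
  rewrite out //; apply/orP; right; move: zP; rewrite !inE negb_or => /andP[zx zP].
  rewrite eq_porbit_mem zP /= imset_f // andbT.
  by apply: contraNneq zx => /setP/(_ z); rewrite porbit_id inE => /esym.
case/predU1P => [->|/and3P[cP cx /imsetP[z _ cz]]]; first by exists y.
exists z => //; rewrite out // !inE negb_or; subst c; apply/andP; split.
  by apply: contraNneq cx => ->; rewrite porbit_fix.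
by rewrite -eq_porbit_mem.
Qed.

Lemma cycle_lengths_insert (T : finType) (s : {perm T}) x y l :
    s x = x -> x != y -> perm_eq (cycle_lengths s) (1%N :: l) ->
  perm_eq (cycle_lengths (s * tperm x y)%g) (#|porbit s y|.+1 :: rem #|porbit s y| l).
Proof.
move=> sx xy sl; rewrite /cycle_lengths porbits_insert //.
have xP : x \notin porbit s y by rewrite porbit_sym (porbit_fix sx) inE eq_sym.
have Px : porbit s y != [set x] by apply: contraNneq xP => ->; rewrite inE.
apply: (perm_trans (perm_map_enum_setU1 _)).
  rewrite !inE negb_and negbK; apply/orP; right; rewrite negb_and; apply/orP; right.
  apply/imsetP => -[z _ zE]; have : x \in porbit s z by rewrite -zE setU11.
  rewrite porbit_sym (porbit_fix sx) inE => /eqP zx.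
  by move/setP/(_ y): zE; rewrite zx (porbit_fix sx) !inE porbit_id orbT eq_sym (negbTE xy).
rewrite cardsU1 xP add1n.
rewrite perm_cons.
have x_in : [set x] \in porbits s by rewrite -(porbit_fix sx) imset_f.
have P_in : porbit s y \in porbits s :\ [set x] by rewrite !inE Px imset_f.
move: sl; rewrite /cycle_lengths -{1}(setD1K x_in) => sl.
have := perm_map_enum_setU1 (_ : [set x] \notin porbits s :\ [set x]).
rewrite !inE eqxx cards1 perm_sym => /(_ isT) /perm_trans/(_ sl).
rewrite perm_cons -{1}(setD1K P_in) perm_sym => sl'.
have := perm_map_enum_setU1 (_ : porbit s y \notin porbits s :\ [set x] :\ porbit s y).
rewrite !inE eqxx => /(_ isT) /(perm_trans sl') sl2; rewrite perm_sym.
rewrite -(perm_cons #|porbit s y|); apply: (perm_trans _ sl2); rewrite perm_sym perm_to_rem //.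
by rewrite (perm_mem sl2) mem_head.
Qed.

Lemma porbit_lift n (s : 'S_n) i :
  porbit (lift_perm ord0 ord0 s) (lift ord0 i) = lift ord0 @: porbit s i.
Proof.
have tX k : ((lift_perm ord0 ord0 s ^+ k) (lift ord0 i) = lift ord0 ((s ^+ k) i))%g.
  elim: k => [|k IH]; first by rewrite !expg0 !perm1.
  by rewrite !expgSr !permM IH lift_perm_lift.
apply/setP => w; apply/porbitP/imsetP => [[k ->]|[v /porbitP[k ->] ->]].
  by exists ((s ^+ k)%g i); rewrite ?mem_porbit.
by exists k; rewrite tX.
Qed.

Lemma cycle_lengths_lift n (s : 'S_n) :
  perm_eq (cycle_lengths (lift_perm ord0 ord0 s)) (1%N :: cycle_lengths s).
Proof.
set t := lift_perm _ _ s.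
have t0 : porbit t ord0 = [set ord0] by apply: porbit_fix; rewrite lift_perm_id.
have tl i : porbit t (lift ord0 i) = lift ord0 @: porbit s i by apply: porbit_lift.
have tE : porbits t = [set ord0] |: (fun c : {set 'I_n} => lift ord0 @: c) @: porbits s.
  apply/setP => c; rewrite !inE; apply/imsetP/orP => [[x _ ->]|[/eqP->|/imsetP[_ /imsetP[i _ ->] ->]]].
  - case: (unliftP ord0 x) => [i ->|->]; [right | by left; rewrite t0].
    by rewrite tl; do 2!apply: imset_f.
  - by exists ord0.
  - by exists (lift ord0 i).
rewrite /cycle_lengths tE (perm_trans (perm_map_enum_setU1 _)) ?cards1 ?perm_cons //.
  apply/imsetP => -[c _ /setP/(_ ord0)]; rewrite inE eqxx => /esym/imsetP[i _] /eqP.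
  by rewrite (negbTE (neq_lift _ _)).
have liftI : injective (fun c : {set 'I_n} => lift ord0 @: c) by apply/imset_inj/lift_inj.
have -> : [seq #|c| | c : {set 'I_n} <- enum (porbits s)] =
    [seq #|c| | c : {set 'I_n.+1} <- [seq lift ord0 @: c | c : {set 'I_n} <- enum (porbits s)]].
  by rewrite -map_comp; apply: eq_map => c /=; rewrite card_imset //; apply: lift_inj.
apply/perm_map/uniq_perm.
- exact: enum_uniq.
- by rewrite map_inj_uniq ?enum_uniq.
- by move=> c; rewrite mem_enum; apply/imsetP/mapP => -[b bs ->]; exists b; rewrite ?mem_enum in bs *.
Qed.

Lemma sum_porbit (T : finType) (s : {perm T}) (F : nat -> nat) :
  (\sum_x F #|porbit s x| = \sum_(k <- cycle_lengths s) k * F k)%N.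
Proof.
rewrite big_map big_enum /= (partition_big (porbit s) (mem (porbits s))) /=; last first.
  by move=> x _; apply: imset_f.
apply: eq_bigr => _ /imsetP[x _ ->].
rewrite (eq_bigr (fun _ => F #|porbit s x|)) => [|y /eqP-> //].
rewrite sum_nat_const; congr (_ * _)%N; apply: eq_card => y.
by rewrite unfold_in /= -eq_porbit_mem.
Qed.

Definition num_of_type n (la : seq nat) : nat :=
  (\sum_(s : 'S_n) perm_eq (cycle_lengths s) la)%N.

Definition insert_perm n (x : 'S_n * 'I_n.+1) : 'S_n.+1 :=
  (lift_perm ord0 ord0 x.1 * tperm ord0 x.2)%g.

Lemma insert_perm_bij n : bijective (@insert_perm n).
Proof.
apply: inj_card_bij => [[s i] [t j] /= E|]; last first.
  by rewrite card_prod !card_Sn card_ord factS mulnC.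
have /= := congr1 (fun g : 'S_n.+1 => g ord0) E.
rewrite /insert_perm /= !permM !lift_perm_id !tpermL => ij; subst j.
move: E; rewrite /insert_perm /= => /mulIg E; congr (_, _); apply/permP => k.
have /= := congr1 (fun g : 'S_n.+1 => g (lift ord0 k)) E.
by rewrite !lift_perm_lift => /lift_inj.
Qed.

(** A part k of l lengthened to k + 1 gives la when l is la with some part i
    shortened to k = i - 1, and then l has one part k more than rem i la. *)
Lemma sum_lengthen_part (l la : seq nat) : 0%N \notin la -> 0%N \notin l ->
  (\sum_(k <- l) k * perm_eq (k.+1 :: rem k l) la =
   \sum_(i <- undup la | i != 1)
     i.-1 * (count_mem i.-1 (rem i la)).+1 * perm_eq l (i.-1 :: rem i la))%N.
Proof.
move=> la0 l0.
transitivity (\sum_(i <- undup la | i != 1) \sum_(k <- l)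
   (i == k.+1) * (k * perm_eq (k.+1 :: rem k l) la))%N.
  rewrite exchange_big /=; apply: eq_big_seq => k kl; rewrite -big_distrl /=.
  have [kla|kla] := boolP (k.+1 \in la); last first.
    rewrite (_ : perm_eq _ _ = false) ?muln0 //; apply: contraNF kla => /perm_mem <-.
    exact: mem_head.
  have k1 : k.+1 != 1%N by rewrite eqSS; apply: contraNneq l0 => <-.
  rewrite big_mkcond (bigD1_seq k.+1) ?mem_undup ?undup_uniq //= k1 eqxx big1 ?mul1n ?addn0 //.
  by move=> i /negbTE->; case: ifP.
rewrite big_seq_cond [RHS]big_seq_cond; apply: eq_bigr => i.
rewrite mem_undup => /andP[ila i1].
have i0 : (0 < i)%N by rewrite lt0n; apply: contraNneq la0 => <-.
rewrite -{1 3 5}(prednK i0); set k := i.-1.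
transitivity (count_mem k l * (k * perm_eq (k.+1 :: rem k l) la))%N.
  rewrite -sum1_count big_distrl /= [RHS]big_mkcond /=; apply: eq_bigr => j _.
  by rewrite eqSS eq_sym; case: eqP => [->|//]; rewrite !mul1n.
rewrite mulnA [in LHS](mulnC _ k) /k prednK // -/k.
have [kl|kl] := boolP (k \in l); last first.
  rewrite (count_memPn kl) muln0 mul0n (_ : perm_eq l _ = false) ?muln0 //.
  by apply: contraNF kl => /perm_mem ->; apply: mem_head.
have -> : perm_eq (i :: rem k l) la = perm_eq l (k :: rem i la).
  rewrite (permPr (perm_to_rem ila)) (permPl (perm_to_rem kl)) !perm_cons.
  by [].
by have [/seq.permP ->|] := boolP (perm_eq l _); rewrite ?muln0 //= eqxx.
Qed.

(** Every permutation of n + 1 points arises once by inserting the point 0, as a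
    fixed point or into a cycle of length k, the latter in k ways. *)
Lemma num_of_type_rec n la : 0%N \notin la ->
  num_of_type n.+1 la =
    (\sum_(i <- undup la)
      if i == 1%N then num_of_type n (rem 1%N la) else
        i.-1 * (count_mem i.-1 (rem i la)).+1 * num_of_type n (i.-1 :: rem i la))%N.
Proof.
move=> la0; rewrite {1}/num_of_type.
have [h hK Kh] := insert_perm_bij n.
rewrite (reindex (@insert_perm n)) /=; last by exists h => x _; [apply: hK | apply: Kh].
rewrite -(pair_big xpredT xpredT (fun s i => nat_of_bool (perm_eq (cycle_lengths (insert_perm (s, i))) la))) /=.
have key (s : 'S_n) : ((\sum_i perm_eq (cycle_lengths (insert_perm (s, i))) la) =
   (perm_eq (1%N :: cycle_lengths s) la +
    \sum_(k <- cycle_lengths s) k * perm_eq (k.+1 :: rem k (cycle_lengths s)) la))%N.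
  rewrite big_ord_recl; congr (_ + _)%N.
    by rewrite /insert_perm /= tperm1 mulg1 (permPl (cycle_lengths_lift s)).
  rewrite -(sum_porbit s (fun k => nat_of_bool (perm_eq (k.+1 :: rem k (cycle_lengths s)) la))).
  apply: eq_bigr => j _; rewrite /insert_perm /=.
  have tj : #|porbit (lift_perm ord0 ord0 s) (lift ord0 j)| = #|porbit s j|.
    rewrite porbit_lift.
    by rewrite card_imset //; apply: lift_inj.
  have := cycle_lengths_insert (lift_perm_id ord0 ord0 s) (neq_lift ord0 j) (cycle_lengths_lift s).
  by rewrite tj => /permPl ->.
under eq_bigr do rewrite key.
rewrite big_split /= (bigID (pred1 1%N)) /=; congr (_ + _)%N.
  have [la1|la1] := boolP (1%N \in la); last first.
    rewrite [RHS]big1_seq => [|i /andP[/eqP->]]; last by rewrite mem_undup (negbTE la1).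
    rewrite big1 // => s _; apply/eqP; rewrite eqb0; apply: contra la1 => /perm_mem <-.
    exact: mem_head.
  rewrite -[RHS]big_filter (_ : [seq i <- undup la | i == 1%N] = [:: 1%N]) ?big_seq1 /=.
    apply: eq_bigr => s _; rewrite -(perm_cons 1%N (cycle_lengths s)).
    by rewrite -(permPr (perm_to_rem la1)).
  apply: perm_small_eq => //; apply: uniq_perm; rewrite ?filter_uniq ?undup_uniq // => i.
  by rewrite mem_filter mem_undup inE; case: eqP => // ->.
under eq_bigr do rewrite sum_lengthen_part ?cycle_lengths_gt0 //.
rewrite exchange_big /=; apply: eq_bigr => i /negbTE ->.
by rewrite -big_distrr.
Qed.

Lemma sum_count_undup (la : seq nat) : (\sum_(i <- undup la) i * count_mem i la = sumn la)%N.
Proof.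
rewrite sumnE -[RHS]big_undup_iterop_count; apply: eq_bigr => i _.
by rewrite Monoid.iteropE iter_addn_0.
Qed.

(** Both sides satisfy the recursion obtained by inserting a point into a
    permutation; the fractions n!/z add up because the sum of the parts,
    counted with multiplicity, is n. *)
Lemma num_of_type_z n la : 0%N \notin la -> sumn la = n ->
  (num_of_type n la * z_part la = n`!)%N.
Proof.
elim: n la => [|n IH] la la0 lan.
  case: la la0 lan => [_ _|[|//] la]; last by rewrite inE.
  rewrite /z_part /aut_part !big_nil muln1 /num_of_type.
  rewrite (eq_bigr (fun=> 1%N)) => [|s _]; first by rewrite sum1_card card_Sn.
  rewrite (_ : cycle_lengths s = [::]) //; apply/nilP; rewrite /nilp size_map -cardE.
  by rewrite cards_eq0; apply/eqP/setP => c; rewrite inE; apply/imsetP => -[[]].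
rewrite num_of_type_rec // big_distrl /= factS -lan -sum_count_undup big_distrl /=.
rewrite big_seq [RHS]big_seq; apply: eq_bigr => i; rewrite mem_undup => ila.
have i0 : (0 < i)%N by rewrite lt0n; apply: contraNneq la0 => <-.
have zE : z_part la = (z_part (rem i la) * (i * count_mem i la))%N.
  rewrite (perm_z_part (perm_to_rem ila)) z_part_cons; congr (_ * (_ * _))%N.
  by rewrite (seq.permP (perm_to_rem ila)) /= eqxx.
have r0 : 0%N \notin rem i la by apply: contra la0; apply: mem_rem.
have sE : (i + sumn (rem i la))%N = n.+1 by rewrite -lan (perm_sumn (perm_to_rem ila)).
case: eqP => [i1|/eqP i1].
  rewrite zE mulnA -{1}i1 IH // 1?mulnC //.
  by apply/eqP; rewrite -eqSS -sE i1.
have := IH (i.-1 :: rem i la).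
rewrite z_part_cons inE negb_or r0 andbT /= => H.
rewrite -H; first by rewrite zE; ring.
- by rewrite eq_sym -lt0n -subn1 subn_gt0 ltn_neqAle eq_sym i1.
- by apply/eqP; rewrite -eqSS -sE -{3}(prednK i0).
Qed.

(** * Pairs of subsets and their stabilizers *)

Lemma perm_of_fibers (C : finType) d (u v : 'I_d -> C) :
    (forall c, #|[set i | u i == c]| = #|[set i | v i == c]|) ->
  exists y : 'S_d, forall i, v i = u (y i).
Proof.
move=> H; have cnt (w : 'I_d -> C) c : count_mem c [tuple w i | i < d] = #|[set i | w i == c]|.
  by rewrite /= count_map -sum1_count big_enum_cond sum1dep_card.
have : perm_eq [tuple v i | i < d] [tuple u i | i < d].
  by apply/allP => c _; rewrite /= !cnt H.
case/tuple_permP => y yE; exists y => i.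
have := congr1 (fun t => tnth t i) (val_inj yE : [tuple v i | i < d] = _).
by rewrite !tnth_mktuple.
Qed.

Section SetStab.
Variable d : nat.
Implicit Types (S T : {set 'I_d}) (g y : 'S_d).
Local Notation N S := 'N(S | 'P)%g.

Lemma stab_setE S g : (g \in N S) = (g @: S == S).
Proof.
apply/idP/eqP => [gN|gS]; first exact: (astabs_setact gN).
by apply/astabsP => x; rewrite /= /aperm -[in LHS]gS (mem_imset _ _ (@perm_inj _ g)).
Qed.

Lemma perm_of_pairs S0 T0 S T :
    #|S0| = #|S| -> #|T0| = #|T| -> #|S0 :&: T0| = #|S :&: T| ->
  exists y : 'S_d, y @: S0 = S /\ y @: T0 = T.
Proof.
move=> eS eT eST.
have [|y yE] := @perm_of_fibers (bool * bool)%type d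
    (fun i => (i \in S, i \in T)) (fun i => (i \in S0, i \in T0)).
  have cE (U V : {set 'I_d}) b c : [set i : 'I_d | (i \in U, i \in V) == (b, c)] =
      (if b then U else ~: U) :&: (if c then V else ~: V).
    by apply/setP => i; rewrite !inE xpair_eqE; case: b c => -[]; rewrite ?inE ?eqb_id ?eqbF_neg.
  have cI (U V : {set 'I_d}) : #|U :&: ~: V| = (#|U| - #|U :&: V|)%N.
    by rewrite -setDE cardsD.
  have cC (U : {set 'I_d}) : #|~: U| = (d - #|U|)%N by rewrite cardsCs setCK card_ord.
  have cII (U V : {set 'I_d}) : #|~: U :&: ~: V| = (d - (#|U| + #|V| - #|U :&: V|))%N.
    by rewrite -setCU cC cardsU.
  have cI' (U V : {set 'I_d}) : #|~: U :&: V| = (#|V| - #|U :&: V|)%N.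
    by rewrite setIC cI setIC.
  by case=> b c; rewrite !cE; case: b c => -[]; rewrite ?cII ?cI ?cI' ?eS ?eT ?eST.
exists y; split; apply/eqP; rewrite eqEcard card_imset ?eS ?eT ?leqnn ?andbT; try exact: perm_inj;
  by apply/subsetP => _ /imsetP[i iS ->]; move: (yE i); rewrite iS => -[].
Qed.

Lemma card_pair_fiber S0 T0 S T y0 : y0 @: S0 = S -> y0 @: T0 = T ->
  #|[set y : 'S_d | (y @: S0 == S) && (y @: T0 == T)]| = #|N S :&: N T|.
Proof.
move=> <- <-; rewrite -(card_lcoset _ y0); apply: eq_card => y.
rewrite mem_lcoset inE in_setI !stab_setE -!imset_comp.
have E (U : {set 'I_d}) : ((y0^-1 * y)%g \o y0) @: U = y @: U.
  by apply: eq_imset => i /=; rewrite permM permK.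
by rewrite !E.
Qed.

(** The y that carry (S0, T0) to a given pair form a coset of its stabilizer. *)
Lemma sum_pair_stab (R : pzSemiRingType) S0 T0 (F : {set 'I_d} -> {set 'I_d} -> R) :
  \sum_(y : 'S_d) F (y @: S0) (y @: T0) =
  \sum_(p : {set 'I_d} * {set 'I_d} |
      [&& #|p.1| == #|S0|, #|p.2| == #|T0| & #|p.1 :&: p.2| == #|S0 :&: T0|])
    #|N p.1 :&: N p.2|%:R * F p.1 p.2.
Proof.
rewrite (partition_big (fun y : 'S_d => (y @: S0, y @: T0)) (fun p : {set 'I_d} * {set 'I_d} =>
   [&& #|p.1| == #|S0|, #|p.2| == #|T0| & #|p.1 :&: p.2| == #|S0 :&: T0|])) /=; last first.
  move=> y _; rewrite -imsetI; last by move=> ? ? _ _ /perm_inj.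
  by rewrite !card_imset ?eqxx //; apply: perm_inj.
apply: eq_bigr => -[S T] /= /and3P[/eqP eS /eqP eT /eqP eST].
have [y0 [y0S y0T]] := perm_of_pairs (esym eS) (esym eT) (esym eST).
rewrite -(card_pair_fiber y0S y0T) mulr_natl -sumr_const.
apply: eq_big => [y|y /eqP[-> ->] //]; by rewrite inE xpair_eqE.
Qed.

Lemma sum_set_stab (R : pzSemiRingType) S0 (F : {set 'I_d} -> R) :
  \sum_(y : 'S_d) F (y @: S0) = #|N S0|%:R * \sum_(S : {set 'I_d} | #|S| == #|S0|) F S.
Proof.
rewrite (partition_big (fun y : 'S_d => y @: S0) (fun S => #|S| == #|S0|)) /=; last first.
  by move=> y _; rewrite card_imset ?eqxx //; apply: perm_inj.
rewrite mulr_sumr; apply: eq_bigr => S /eqP eS.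
have [|y0 [y0S _]] := perm_of_pairs (esym eS) (esym eS); first by rewrite !setIid.
rewrite -(card_rcoset _ y0) mulr_natl -sumr_const; apply: eq_big => [y|y /eqP-> //].
rewrite mem_rcoset stab_setE -{1}y0S.
have -> : (y * y0^-1)%g @: S0 = y0^-1%g @: (y @: S0).
  by rewrite -imset_comp; apply: eq_imset => i /=; rewrite permM.
apply/eqP/eqP => [->|E].
  by rewrite -imset_comp -[RHS]imset_id; apply: eq_imset => i /=; rewrite permK.
by rewrite -[in RHS]E -imset_comp -[LHS]imset_id; apply: eq_imset => i /=; rewrite permKV.
Qed.

Lemma card_stab S : (#|N S| * 'C(d, #|S|))%N = d`!.
Proof.
have := sum_set_stab S (fun _ => 1%N); rewrite !sum1_card card_Sn.
by have := card_draws 'I_d #|S|; rewrite cardsE card_ord => <- ->; rewrite natn.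
Qed.

(** * The sign on an invariant subset *)

Definition sgn_on S g : algC := (-1) ^+ odd_perm (restr_perm S g).

Lemma sgn_onM S g h : g \in N S -> h \in N S -> sgn_on S (g * h)%g = sgn_on S g * sgn_on S h.
Proof. by move=> gN hN; rewrite /sgn_on morphM // odd_permM signr_addb. Qed.

Lemma stab_conj S g y : (g ^ y \in N (y @: S))%g = (g \in N S).
Proof.
rewrite !stab_setE; have -> : (g ^ y)%g @: (y @: S) = y @: (g @: S).
  by rewrite -!imset_comp; apply: eq_imset => i /=; rewrite permJ.
by rewrite (inj_eq (imset_inj (@perm_inj _ y))).
Qed.

Lemma sgn_on_conj S g y : g \in N S -> sgn_on (y @: S) (g ^ y)%g = sgn_on S g.
Proof.
move=> gN; rewrite /sgn_on; suff -> : restr_perm (y @: S) (g ^ y)%g = (restr_perm S g ^ y)%g.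
  by rewrite odd_permJ.
apply/permP => i; rewrite -[i](permKV y) permJ; set j := (y^-1)%g i.
have [jS|jS] := boolP (j \in S).
  by rewrite !restr_permE ?stab_conj ?imset_f // permJ.
rewrite (out_perm (restr_perm_on _ _)) ?(mem_imset _ _ (@perm_inj _ y)) //.
by rewrite (out_perm (restr_perm_on _ _)).
Qed.

Lemma sgn_on_real S g : (sgn_on S g)^* = sgn_on S g.
Proof. by rewrite /sgn_on rmorph_sign. Qed.

Lemma sign_repr_proof : mx_repr [set: 'S_d] (fun g : 'S_d => ((-1) ^+ odd_perm g)%:M : 'M[algC]_1).
Proof. by split=> [|g h _ _]; rewrite ?odd_perm1 // odd_permM signr_addb scalar_mxM. Qed.

Lemma sign_char_lin : sign_char d \is a linear_char.
Proof.
rewrite qualifE /= cfunE odd_perm1 eqxx andbT.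
suff -> : sign_char d = cfRepr (MxRepresentation sign_repr_proof) by apply: cfRepr_char.
by apply/cfunP => g; rewrite !cfunE inE mulr1n mxtrace_scalar.
Qed.

Definition set_sign S : 'CF(N S) := cfMorph ('Res[restr_perm S @* N S] (sign_char d)).

Lemma set_signE S g : set_sign S g = if g \in N S then sgn_on S g else 0.
Proof.
case: ifP => gN; last by rewrite cfun0 ?gN.
by rewrite cfMorphE // cfResE ?subsetT ?mem_morphim // cfunE.
Qed.

Lemma set_sign_lin S : set_sign S \is a linear_char.
Proof. by rewrite cfMorph_lin_char // cfRes_lin_char // sign_char_lin. Qed.

(** The induced character is the trace on an exterior power of the
    permutation module. *)
Lemma Ind_set_signE S g : 'Ind[[set: 'S_d]] (set_sign S) g =
  \sum_(T : {set 'I_d} | (#|T| == #|S|) && (g \in N T)) sgn_on T g.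
Proof.
rewrite cfIndE ?subsetT //.
transitivity (#|N S|%:R^-1 * \sum_(y : 'S_d) (if g \in N (y @: S) then sgn_on (y @: S) g else 0)).
  congr (_ * _); rewrite (reindex_inj invg_inj) /=; apply: eq_big => [y|y _]; first by rewrite inE.
  rewrite set_signE; set T := y @: S.
  have -> : S = (y^-1)%g @: T.
    by rewrite -imset_comp -[LHS]imset_id; apply: eq_imset => i /=; rewrite permK.
  by rewrite stab_conj; case: ifP => // gN; rewrite sgn_on_conj.
rewrite (sum_set_stab S (fun T => if g \in N T then sgn_on T g else 0)) mulKf ?neq0CG //.
by rewrite big_mkcondr.
Qed.
End SetStab.

(** * Inner products *)

(** For j <= d, the character of the j-th exterior power of the permutation
    module. *)
Definition ext_char d j : 'CF([set: 'S_d]) :=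
  'Ind[[set: 'S_d]] (set_sign [set i : 'I_d | (i < j)%N]).

Lemma card_ord_lt d j : (j <= d)%N -> #|[set i : 'I_d | (i < j)%N]| = j.
Proof.
move=> jd; have inj : injective (widen_ord jd) by move=> x y /(congr1 val) /= /val_inj.
rewrite -[RHS]card_ord -(card_imset _ inj).
apply: eq_card => i; rewrite inE; apply/idP/imsetP => [ij|[k _ ->] //=].
by exists (Ordinal ij) => //; apply: val_inj.
Qed.

Section ExtChar.
Variable d : nat.
Implicit Types (S T : {set 'I_d}) (g : 'S_d).
Local Notation N S := 'N(S | 'P)%g.

Lemma ext_charE j g : (j <= d)%N -> ext_char d j g =
  \sum_(T : {set 'I_d} | (#|T| == j) && (g \in N T)) sgn_on T g.
Proof. by move=> jd; rewrite Ind_set_signE card_ord_lt. Qed.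

Lemma ext_charS S : ext_char d #|S| = 'Ind[[set: 'S_d]] (set_sign S).
Proof.
apply/cfunP => g; rewrite ext_charE ?Ind_set_signE //.
by rewrite -[leqRHS](card_ord d) max_card.
Qed.

Lemma ext_char_char j : ext_char d j \is a character.
Proof. by rewrite cfInd_char // lin_charW // set_sign_lin. Qed.

Definition pair_sum S T : algC := \sum_(g in N S :&: N T) sgn_on S g * sgn_on T g.

Lemma pair_sumC S T : pair_sum S T = pair_sum T S.
Proof. by rewrite /pair_sum setIC; apply: eq_bigr => g _; rewrite mulrC. Qed.

Lemma tperm_stab S a b : (a \in S) = (b \in S) -> tperm a b \in N S.
Proof.
move=> ab; rewrite stab_setE; apply/eqP/setP => x; apply/imsetP/idP => [[y yS ->]|xS].
  by case: tpermP => // yE; rewrite yE in yS; rewrite ?ab // -ab.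
exists (tperm a b x); last by rewrite tpermK.
by case: tpermP xS => // -> ; rewrite ?ab // -ab.
Qed.

Lemma sgn_on_tperm S a b : a != b -> a \in S -> b \in S -> sgn_on S (tperm a b) = -1.
Proof.
move=> ab aS bS; rewrite /sgn_on; suff -> : restr_perm S (tperm a b) = tperm a b.
  by rewrite odd_tperm ab.
apply/permP => x; have [xS|xS] := boolP (x \in S); first by rewrite restr_permE // tperm_stab // aS bS.
rewrite (out_perm (restr_perm_on _ _)) // tpermD //; by apply: contraNneq xS => <-.
Qed.

Lemma sgn_on_tperm_out S a b : a \notin S -> b \notin S -> sgn_on S (tperm a b) = 1.
Proof.
move=> aS bS; rewrite /sgn_on; suff -> : restr_perm S (tperm a b) = 1%g by rewrite odd_perm1.
apply/permP => x; rewrite perm1; have [xS|xS] := boolP (x \in S); last exact: out_perm (restr_perm_on _ _) _.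
rewrite restr_permE ?tperm_stab ?(negbTE aS) ?(negbTE bS) // tpermD //.
  by apply: contraNneq aS => ->.
by apply: contraNneq bS => ->.
Qed.

(** A transposition of two points of S outside T reverses the summand. *)
Lemma pair_sum_eq0 S T : (1 < #|S :\: T|)%N -> pair_sum S T = 0.
Proof.
case/card_gt1P => a [b [aST bST ab]]; move: aST bST; rewrite !inE => /andP[aT aS] /andP[bT bS].
have tS : tperm a b \in N S by rewrite tperm_stab // aS bS.
have tT : tperm a b \in N T by rewrite tperm_stab // (negbTE aT) (negbTE bT).
have tST : tperm a b \in N S :&: N T by apply/setIP.
apply/eqP; rewrite -[_ == 0](mulrn_eq0 _ 2) //= mulr2n addr_eq0; apply/eqP.
rewrite {1}/pair_sum (reindex_inj (mulIg (tperm a b))) /= -sumrN.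
apply: eq_big => [g|g]; first by rewrite groupMr.
rewrite groupMr // => /setIP[gS gT].
by rewrite !sgn_onM // (sgn_on_tperm ab) // sgn_on_tperm_out // mulr1 mulrN1 mulNr.
Qed.

(** The only point that S may have outside T is fixed by g. *)
Lemma restr_perm_setI S T g : (#|S :\: T| <= 1)%N -> g \in N S -> g \in N T ->
  restr_perm S g = restr_perm (S :&: T) g.
Proof.
move=> ST gS gT; have gST : g \in N (S :&: T).
  by rewrite (subsetP (astabsI _ _ _)) //; apply/setIP.
apply/permP => x; have [xS|xS] := boolP (x \in S); last first.
  by rewrite !(out_perm (restr_perm_on _ _)) // inE negb_and xS.
have [xT|xT] := boolP (x \in T); first by rewrite !restr_permE // inE xS.
rewrite restr_permE // (out_perm (restr_perm_on (S :&: T) _)) ?inE ?negb_and ?xT ?orbT //.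
have /card_le1_eqP := ST; apply; rewrite !inE ?xT ?xS //.
by have /= := astabs_act x gS; have /= := astabs_act x gT; rewrite /aperm => -> ->; rewrite xT.
Qed.

Lemma pair_sum_stab S T : (#|S :\: T| <= 1)%N -> (#|T :\: S| <= 1)%N ->
  pair_sum S T = #|N S :&: N T|%:R.
Proof.
move=> ST TS; rewrite /pair_sum -sumr_const; apply: eq_bigr => g /setIP[gS gT].
rewrite /sgn_on (restr_perm_setI ST) // (restr_perm_setI TS) // setIC.
by rewrite -expr2 sqrr_sign.
Qed.
Lemma card_ord_interval a b : (a <= b)%N -> (b <= d)%N ->
  #|[set x : 'I_d | (a <= x < b)%N]| = (b - a)%N.
Proof.
move=> ab bd; have -> : [set x : 'I_d | (a <= x < b)%N] =
    [set x : 'I_d | (x < b)%N] :\: [set x : 'I_d | (x < a)%N].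
  by apply/setP => x; rewrite !inE -leqNgt.
rewrite cardsD (setIidPr _) ?card_ord_lt //; first exact: leq_trans ab bd.
by apply/subsetP => x; rewrite !inE => /leq_trans; apply.
Qed.

(** The orbit of a pair of sets is cut out by the three cardinalities. *)
Lemma sum_pair_stab_card i j m : (m <= i)%N -> (m <= j)%N ->
  \sum_(p : {set 'I_d} * {set 'I_d} |
      [&& #|p.1| == i, #|p.2| == j & #|p.1 :&: p.2| == m]) #|N p.1 :&: N p.2|%:R
    = (if (i + j - m <= d)%N then d`!%:R else 0) :> algC.
Proof.
move=> mi mj; case: leqP => ijm; last first.
  rewrite big_pred0 // => -[S T] /=; apply/and3P => -[/eqP Si /eqP Tj /eqP STm].
  have := max_card (mem (S :|: T)); rewrite card_ord cardsU Si Tj STm.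
  by rewrite leqNgt ijm.
(* Two intervals of lengths i and j with m points in common. *)
pose S0 := [set x : 'I_d | (0 <= x < i)%N].
pose T0 := [set x : 'I_d | (i - m <= x < i - m + j)%N].
have S0E : #|S0| = i by rewrite card_ord_interval ?subn0 //; lia.
have T0E : #|T0| = j by rewrite card_ord_interval; lia.
have ST0E : #|S0 :&: T0| = m.
  have -> : S0 :&: T0 = [set x : 'I_d | (i - m <= x < i)%N].
    by apply/setP => x; rewrite !inE; apply/idP/idP; lia.
  by rewrite card_ord_interval; lia.
have := sum_pair_stab S0 T0 (fun _ _ => 1 : algC).
rewrite S0E T0E ST0E sumr_const card_Sn => ->.
by apply: eq_bigr => p _; rewrite mulr1.
Qed.

(** Only pairs of sets that differ in at most one point on either side
    contribute, and each orbit of such pairs contributes 1. *)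
Lemma ext_char_dot i j : (i <= d)%N -> (j <= d)%N ->
  '[ext_char d i, ext_char d j] =
    ((i == j) + ((i == j) && (0 < i < d)%N) + (i == j.+1) + (j == i.+1))%:R.
Proof.
move=> id jd; rewrite cfdotE cardsT card_Sn.
transitivity (d`!%:R^-1 * \sum_(p : {set 'I_d} * {set 'I_d} | (#|p.1| == i) && (#|p.2| == j)) pair_sum p.1 p.2).
  congr (_ * _); rewrite /pair_sum (exchange_big_dep predT) //=.
  apply: eq_big => [g|g _]; first by rewrite inE.
  rewrite !ext_charE // rmorph_sum /= big_distrlr /= pair_big_dep /=.
  apply: eq_big => [[S T]|[S T] _] /=; last by rewrite sgn_on_real.
  by rewrite (in_setI g (N S) (N T)); case: (#|S| == i); case: (#|T| == j); case: (g \in N S); case: (g \in N T).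
rewrite (partition_big (fun p : {set 'I_d} * {set 'I_d} => inord #|p.1 :&: p.2| : 'I_d.+1) xpredT) //=.
rewrite mulr_sumr.
have key (m : 'I_d.+1) : d`!%:R^-1 * (\sum_(p : {set 'I_d} * {set 'I_d} |
     (#|p.1| == i) && (#|p.2| == j) && (inord #|p.1 :&: p.2| == m)) pair_sum p.1 p.2) =
   ((m == i :> nat) * ((j == i) + (j == i.+1)) + (m.+1 == i :> nat) * ((j.+1 == i) + ((j == i) && (i < d)%N)))%:R.
  have inE' (p : {set 'I_d} * {set 'I_d}) : (inord #|p.1 :&: p.2| == m) = (#|p.1 :&: p.2| == m :> nat).
    by rewrite -val_eqE /= inordK // ltnS -[leqRHS](card_ord d) max_card.
  have [mij|mij] := boolP [&& m <= i, i <= m.+1, m <= j & j <= m.+1]%N; last first.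
    rewrite big1 ?mulr0; last first.
      case=> S T /=; rewrite (inE' (S, T)) /= => /andP[/andP[/eqP Si /eqP Tj] /eqP STm].
      have mi : (m <= i)%N by rewrite -Si -STm subset_leq_card ?subsetIl.
      have mj : (m <= j)%N by rewrite -Tj -STm subset_leq_card ?subsetIr.
      move: mij; rewrite mi mj /= negb_and -!ltnNge => /orP[mi1|mj1].
        by rewrite pair_sum_eq0 // cardsD Si STm; lia.
      by rewrite pair_sumC pair_sum_eq0 // cardsD Tj setIC STm; lia.
    by rewrite [X in _ = X%:R](_ : _ = 0%N) // !mulnDr !mulnb; lia.
  case/and4P: mij => mi im mj jm.
  transitivity (d`!%:R^-1 * (if (i + j - m <= d)%N then d`!%:R else 0 : algC)).
    congr (_ * _); rewrite -sum_pair_stab_card //.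
    apply: eq_big => [p|[S T] /=]; first by rewrite inE' andbA.
    rewrite (inE' (S, T)) /= => /andP[/andP[/eqP Si /eqP Tj] /eqP STm].
    have TSm : #|T :&: S| = m by rewrite setIC.
    by rewrite pair_sum_stab // cardsD ?STm ?TSm ?Si ?Tj; lia.
  case: (leqP (i + j - m) d) => ijm; rewrite ?mulr0 ?mulVf ?pnatr_eq0 -?lt0n ?fact_gt0 //.
    by rewrite [X in _ = X%:R](_ : _ = 1%N) // !mulnDr !mulnb; lia.
  by rewrite [X in _ = X%:R](_ : _ = 0%N) // !mulnDr !mulnb; lia.
under eq_bigr do rewrite key.
rewrite -natr_sum big_split /= -!big_distrl /=; congr (_%:R).
have s1 k : (\sum_(m < d.+1) (m == k :> nat) = (k <= d))%N.
  case: leqP => kd; last by rewrite big1 // => m _; apply/eqP; rewrite eqb0; move: (ltn_ord m); lia.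
  by rewrite (bigD1 (inord k)) //= inordK // eqxx big1 // => m; rewrite -val_eqE /= inordK // => /negbTE->.
have s2 : (\sum_(m < d.+1) (m.+1 == i :> nat) = (0 < i))%N.
  case: (i) id => [|k] kd; first by rewrite big1.
  by under eq_bigr do rewrite eqSS; rewrite s1 ltnW.
rewrite s1 s2 id; lia.
Qed.
End ExtChar.

(** * Hook characters *)

Section Hooks.
Variable d : nat.
Implicit Types (S T : {set 'I_d}) (g : 'S_d).
Local Notation N S := 'N(S | 'P)%g.

(** The exterior power j of the permutation module is the sum of the hook
    characters j and j - 1. *)
Fixpoint hook_cfun (j : nat) : 'CF([set: 'S_d]) :=
  if j is j'.+1 then ext_char d j - hook_cfun j' else ext_char d 0.

Lemma hook_ext_dot i j : (i < d)%N -> (j <= d)%N ->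
  '[hook_cfun i, ext_char d j] = ((i == j) + (i.+1 == j))%:R.
Proof.
move=> id jd; elim: i id => [|i IH] id /=.
  by rewrite ext_char_dot //; congr (_%:R); rewrite !(eq_sym j) andbF addn0 addn0.
rewrite cfdotBl IH ?(ltnW id) // ext_char_dot ?(ltnW id) // id andbT.
apply/eqP; rewrite subr_eq -natrD eqr_nat; apply/eqP; lia.
Qed.

Lemma hook_dot i j : (i < d)%N -> (j < d)%N -> '[hook_cfun i, hook_cfun j] = (i == j)%:R.
Proof.
move=> id jd; elim: j jd => [|j IH] jd /=.
  by rewrite hook_ext_dot // addn0.
rewrite cfdotBr IH ?(ltnW jd) // hook_ext_dot ?(ltnW jd) //.
by rewrite eqSS natrD addrK.
Qed.

(** A virtual character of norm 1 is irreducible up to sign, and the sign is that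
    of its inner product with an exterior power, which is a character. *)
Lemma hook_irr j : (j < d)%N -> exists i, hook_cfun j = 'chi_i.
Proof.
move=> jd; have hZ : hook_cfun j \in 'Z[irr [set: 'S_d]]%g.
  by elim: (j) => [|k IH] /=; rewrite ?rpredB // char_vchar // ext_char_char.
have [|b [i hE]] := vchar_norm1P hZ; first by rewrite hook_dot // eqxx.
exists i; have := hook_ext_dot jd (ltnW jd).
rewrite eqxx gtn_eqF // addn0 hE cfdotZl.
have /natrP[m ->] : '['chi_i, ext_char d j] \in Num.nat.
  by rewrite Cnat_cfdot_char ?irr_char ?ext_char_char.
case: b hE => hE; rewrite ?expr0 ?scale1r //= expr1 mulN1r => /eqP.
by rewrite eq_sym -subr_eq0 opprK addrC natr1 pnatr_eq0.
Qed.

(** The restriction of g to S has the cycles of g inside S and a fixed point for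
    each point outside S. *)
Lemma sgn_onE S g : g \in N S ->
  sgn_on S g = (-1) ^+ (#|S| + #|[set c in porbits g | c \subset S]|)%N.
Proof.
move=> gS; rewrite /sgn_on -[RHS]signr_odd; congr (_ ^+ nat_of_bool _).
set P := [set c in porbits g | c \subset S].
have inS x : x \in S -> porbit (restr_perm S g) x = porbit g x /\ porbit g x \subset S.
  move=> xS; have E k : (restr_perm S g ^+ k)%g x = (g ^+ k)%g x /\ (g ^+ k)%g x \in S.
    elim: k => [|k [IH1 IH2]]; first by rewrite !expg0 !perm1.
    rewrite !expgSr !permM IH1 restr_permE //; split=> //.
    by have /= -> := astabs_act ((g ^+ k)%g x) gS.
  split; last by apply/subsetP => y /porbitP[k ->]; case: (E k).
  by apply/setP => y; apply/porbitP/porbitP => -[k ->]; exists k; case: (E k).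
have outS x : x \notin S -> porbit (restr_perm S g) x = [set x].
  by move=> xS; rewrite porbit_fix // (out_perm (restr_perm_on _ _)).
have -> : odd_perm (restr_perm S g) = odd d (+) odd #|porbits (restr_perm S g)|.
  by rewrite /odd_perm card_ord.
have -> : porbits (restr_perm S g) = P :|: set1 @: ~: S.
  apply/setP => c; rewrite !inE; apply/imsetP/orP => [[x _ ->]|[/andP[/imsetP[x _ ->]]|]].
  - have [xS|xS] := boolP (x \in S); [left|right].
      by have [-> ->] := inS x xS; rewrite andbT imset_f.
    by rewrite outS // imset_f // inE.
  - move/subsetP/(_ _ (porbit_id _ _)) => xS; exists x => //.
    by case: (inS x xS).
  - case/imsetP => x; rewrite inE => xS ->; exists x => //; by rewrite outS.
rewrite cardsU (_ : P :&: _ = set0) ?cards0 ?subn0; last first.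
  apply/setP => c; rewrite !inE; apply/negP => /andP[/andP[_ cS] /imsetP[x xS cE]].
  by move: cS; rewrite cE sub1set; apply/negP; rewrite inE in xS.
rewrite card_imset; last exact: set1_inj.
rewrite (cardsCs (~: S)) setCK card_ord !oddD oddB; last by rewrite -[leqRHS](card_ord d) max_card.
by case: (odd d); case: (odd #|S|); case: (odd #|P|).
Qed.

Lemma prod1D_subset (R : comPzRingType) (I : finType) (A : {set I}) (a : I -> R) :
  \prod_(i in A) (1 + a i) = \sum_(D : {set I} | D \subset A) \prod_(i in D) a i.
Proof.
pose F i (b : bool) := if b then (if i \in A then a i else 0) else 1.
transitivity (\prod_i \sum_b F i b).
  rewrite big_mkcond; apply: eq_bigr => i _; rewrite big_bool /F.
  by case: (i \in A); [apply: addrC | apply/esym/add0r].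
rewrite bigA_distr_bigA.
rewrite (reindex (fun D : {set I} => [ffun i => i \in D])) /=; last first.
  exists (fun f : {ffun I -> bool} => [set i | f i]) => [D _|f _].
    by apply/setP => i; rewrite inE ffunE.
  by apply/ffunP => i; rewrite ffunE inE.
rewrite [RHS]big_mkcond; apply: eq_bigr => D _.
case: ifP => [/subsetP DA|/negbT/subsetPn[i iD iA]].
  rewrite [RHS]big_mkcond; apply: eq_bigr => i _; rewrite ffunE /F.
  by case: ifP => // /DA ->.
by rewrite (bigD1 i) //= ffunE iD /F (negbTE iA) mul0r.
Qed.

(** A g-invariant set is a union of cycles; expanding the product of the
    1 - X^|c| over the cycles lists all of them. *)
Lemma ext_char_gen g :
  \sum_(j < d.+1) ((-1) ^+ j * ext_char d j g) *: 'X^j =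
  \prod_(k <- cycle_lengths g) (1 - 'X^k) :> {poly algC}.
Proof.
transitivity (\sum_(S : {set 'I_d} | g \in N S) ((-1) ^+ #|S| * sgn_on S g) *: 'X^#|S| : {poly algC}).
  rewrite (partition_big (fun S : {set 'I_d} => inord #|S| : 'I_d.+1) xpredT) //=.
  apply: eq_bigr => j _; rewrite ext_charE -1?ltnS // mulr_sumr scaler_suml.
  have jE S : (inord #|S| == j) = (#|S| == j).
    by rewrite -val_eqE /= inordK // ltnS -[leqRHS](card_ord d) max_card.
  by apply: eq_big => [S|S /andP[/eqP-> _] //]; rewrite jE andbC.
rewrite big_map big_enum /= prod1D_subset.
pose P S := [set c in porbits g | c \subset S].
have PN S : g \in N S -> cover (P S) = S.
  move=> gS; apply/setP => x; apply/bigcupP/idP => [[c]|xS].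
    by rewrite inE => /andP[_ /subsetP]; apply.
  exists (porbit g x); rewrite ?porbit_id // inE imset_f //=.
  apply/subsetP => y /porbitP[k ->]; elim: k => [|k IH]; first by rewrite expg0 perm1.
  by rewrite expgSr permM; have /= -> := astabs_act ((g ^+ k)%g x) gS.
have NC (D : {set {set 'I_d}}) : D \subset porbits g -> g \in N (cover D).
  move/subsetP => Dp; rewrite stab_setE eqEcard card_imset ?leqnn ?andbT; last exact: perm_inj.
  apply/subsetP => _ /imsetP[x /bigcupP[c cD xc] ->]; apply/bigcupP; exists c => //.
  by have /imsetP[y _ cE] := Dp c cD; move: xc; rewrite cE porbit_closed.
have CP (D : {set {set 'I_d}}) : D \subset porbits g -> P (cover D) = D.
  move=> Dp; apply/setP => c; rewrite inE; apply/andP/idP => [[/imsetP[x _ ->] /subsetP/(_ x (porbit_id _ _))]|cD].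
    case/bigcupP => c' c'D; have /imsetP[y _ cE] := subsetP Dp _ c'D.
    by rewrite cE -eq_porbit_mem => /eqP ->; rewrite -cE.
  by split; [apply: (subsetP Dp) | apply: bigcup_sup].
rewrite (reindex_onto P (fun D => cover D)) /=; last by [].
apply: eq_big => [S|S gS].
  apply/idP/andP => [gS|[sP /eqP <-]]; last exact: NC.
  by rewrite PN //; split=> //; apply/subsetP => c; rewrite inE => /andP[].
rewrite sgn_onE // -[P S]/(P S) exprD mulrA -expr2 sqrr_sign mul1r.
have trivP : trivIset (P S).
  apply/trivIsetP => b c; rewrite !inE => /andP[/imsetP[x _ ->] _] /andP[/imsetP[y _ ->] _] xy.
  rewrite -setI_eq0; apply/set0Pn => -[z /setIP[]]; rewrite -!eq_porbit_mem => /eqP E1 /eqP E2.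
  by rewrite -E1 E2 eqxx in xy.
have cardE : #|S| = (\sum_(c in P S) #|c|)%N by rewrite -[in LHS](PN S gS) -(eqP trivP).
rewrite prodrN -[\prod_(c in P S) 'X^_]expr_sum -cardE.
by rewrite -[in RHS]polyC1 -polyCN -polyC_exp mul_polyC.
Qed.

Lemma hook_cfun_partial_sum j g : 
  (-1) ^+ j * hook_cfun j g = \sum_(i < j.+1) (-1) ^+ i * ext_char d i g.
Proof.
elim: j => [|j IH] /=; first by rewrite big_ord1.
by rewrite big_ord_recr /= -IH !cfunE mulrBr exprS !mulN1r !mulNr opprK addrC.
Qed.

Lemma ext_char_coef j g : (j <= d)%N ->
  (-1) ^+ j * ext_char d j g = (\prod_(k <- cycle_lengths g) (1 - 'X^k) : {poly algC})`_j.
Proof.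
move=> jd; rewrite -ext_char_gen -(poly_def _ (fun j => (-1) ^+ j * ext_char d j g)).
by rewrite coef_poly ltnS jd.
Qed.

Lemma hook_cfun_coef j g : (j < d)%N ->
  (-1) ^+ j * hook_cfun j g =
  \sum_(i < j.+1) (\prod_(k <- cycle_lengths g) (1 - 'X^k) : {poly algC})`_i.
Proof.
move=> jd; rewrite hook_cfun_partial_sum; apply: eq_bigr => i _.
by rewrite ext_char_coef // (leq_trans _ (ltnW jd)) // -ltnS.
Qed.

(** The generating polynomial of the exterior powers only sees the cycle
    lengths. *)
Lemma eq_hook_cfun j g h : (j < d)%N -> perm_eq (cycle_lengths g) (cycle_lengths h) ->
  hook_cfun j g = hook_cfun j h.
Proof.
move=> jd gh; apply: (mulfI (_ : (-1) ^+ j != 0)); first by rewrite signr_eq0.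
by rewrite !hook_cfun_coef // (perm_big _ gh).
Qed.

Lemma hook_cfun_cycle j g : (j < d)%N -> perm_eq (cycle_lengths g) [:: d] ->
  hook_cfun j g = (-1) ^+ j.
Proof.
move=> jd gd; apply: (mulfI (_ : (-1) ^+ j != 0)); first by rewrite signr_eq0.
rewrite hook_cfun_coef // (perm_big _ gd) big_seq1 -expr2 sqrr_sign.
rewrite big_ord_recl big1 => [|i _] /=; rewrite coefB coef1 coefXn /=.
  by rewrite ltn_eqF ?(leq_ltn_trans _ jd) // subr0 addr0.
by rewrite /bump /= add1n ltn_eqF ?subrr // (leq_ltn_trans _ jd).
Qed.

Lemma sum_partial_sums (e : nat -> algC) n :
  (1 - 'X) * \sum_(j < n) (\sum_(i < j.+1) e i) *: 'X^j =
  \sum_(i < n) e i *: 'X^i - (\sum_(i < n) e i) *: 'X^n :> {poly algC}.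
Proof.
elim: n => [|n IH]; first by rewrite !big_ord0 mulr0 scale0r subr0.
rewrite [in LHS]big_ord_recr mulrDr IH [in RHS]big_ord_recr /=.
rewrite [\sum_(i < n.+1) e i]big_ord_recr /= exprS -!mul_polyC polyCD.
by ring.
Qed.

(** Taking partial sums is dividing by 1 - X; the remainder vanishes because the
    product over the cycles is zero at X = 1. *)
Lemma hook_cfun_gen g : (0 < d)%N ->
  (1 - 'X) * \sum_(j < d) ((-1) ^+ j * hook_cfun j g) *: 'X^j =
  \prod_(k <- cycle_lengths g) (1 - 'X^k) :> {poly algC}.
Proof.
move=> d0; rewrite (eq_bigr (fun j : 'I_d =>
  (\sum_(i < j.+1) (-1) ^+ i * ext_char d i g) *: 'X^j)); last first.
  by move=> j _; rewrite hook_cfun_partial_sum.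
rewrite (sum_partial_sums (fun i => (-1) ^+ i * ext_char d i g)).
rewrite -ext_char_gen big_ord_recr /=; congr (_ + _).
apply/eqP; rewrite eq_sym -addr_eq0 -scalerDl addrC.
have := congr1 (horner^~ 1) (ext_char_gen g); rewrite /= horner_prod horner_sum.
rewrite (eq_bigr (fun j : 'I_d.+1 => (-1) ^+ j * ext_char d j g)); last first.
  by move=> j _; rewrite hornerZ hornerXn expr1n mulr1.
rewrite big_ord_recr /= => ->.
have : (0 < size (cycle_lengths g))%N.
  by rewrite size_map -cardE; apply/card_gt0P; exists (porbit g (Ordinal d0)); apply: imset_f.
case: (cycle_lengths g) => // k l _; rewrite big_cons hornerD hornerN hornerXn expr1n hornerC.
by rewrite subrr mul0r scale0r.
Qed.
End Hooks.

(** * The labelling of the hook characters *)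

Definition hook_part d j : seq nat := (d - j)%N :: nseq j 1%N.

Lemma conj_hook_part d j : (j < d)%N -> conj_part (hook_part d j) = hook_part d (d - j.+1).
Proof.
move=> jd; rewrite /conj_part /hook_part /=.
have -> : (d - j = (d - j.+1).+1)%N by lia.
rewrite /= count_nseq /= mul1n (_ : (d - (d - j.+1) = j.+1)%N); last by lia.
congr (_ :: _); apply: (@eq_from_nth _ 0%N); rewrite ?size_map ?size_iota ?size_nseq // => i id.
rewrite (nth_map 0%N) ?size_iota // nth_iota // nth_nseq id /=.
by rewrite count_nseq /= mul0n addn0 ltnS id.
Qed.

Lemma reshape_index_cons m sh i :
  reshape_index (m :: sh) i = if (i < m)%N then 0%N else (reshape_index sh (i - m)).+1.
Proof.
by rewrite /reshape_index /= subn_eq0; case: ltnP => // mi; rewrite subSn.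
Qed.

Lemma reshape_index_nseq1 j i : (i <= j)%N -> reshape_index (nseq j 1%N) i = i.
Proof.
elim: j i => [|j IH] [|i] ij //; rewrite reshape_index_cons //=.
by rewrite subn1 IH.
Qed.

Lemma young_hookE d j (g : 'S_d) : (j <= d)%N ->
  (g \in young d (hook_part d j)) = perm_on [set i : 'I_d | (i < d - j)%N] g.
Proof.
move=> jd; rewrite inE.
have rE (i : 'I_d) : reshape_index (hook_part d j) i =
    if (i < d - j)%N then 0%N else (i - (d - j)).+1.
  by rewrite reshape_index_cons; case: ifP => // _; rewrite reshape_index_nseq1 //; have := ltn_ord i; lia.
apply/forallP/subsetP => [H x|H x].
  rewrite !inE => gx; rewrite ltnNge; apply: contra gx => xd; move: (H x); rewrite !rE.
  rewrite (ltnNge x) xd /=; case: ltnP => //= gxd; rewrite eqSS.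
  by move=> /eqP E; apply/eqP/val_inj; rewrite /= -(subnK xd) -(subnK gxd) E.
have gon : perm_on [set i : 'I_d | (i < d - j)%N] g by apply/subsetP.
rewrite !rE; have := perm_closed x gon; rewrite !inE => ->.
by case: ltnP => // xd; rewrite (out_perm gon) // inE -leqNgt.
Qed.

(** By transitivity of induction, since phi is a constituent of the character
    induced from its own restriction. *)
Lemma constt_Ind_sub (gT : finGroupType) (G H A : {group gT}) (phi : 'CF(H)) (psi : 'CF(A)) i :
    A \subset H -> H \subset G -> phi \is a linear_char -> 'Res[A] phi = psi ->
  i \in irr_constt ('Ind[G] phi) -> i \in irr_constt ('Ind[G] psi).
Proof.
move=> AH HG lin <- iphi; rewrite -(cfIndInd _ HG AH).
have /irrP[k phiE] := lin_char_irr lin.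
have Ic : 'Ind[H] ('Res[A] phi) \is a character.
  by rewrite cfInd_char // cfRes_char // lin_charW.
have : k \in irr_constt ('Ind[H] ('Res[A] phi)).
  have : '['Res[A] phi] = 1.
    by have /irrP[m ->] := lin_char_irr (cfRes_lin_char A lin); rewrite cfnorm_irr.
  by move=> r1; rewrite irr_consttE -phiE -cfdot_Res_r r1 oner_eq0.
case/(constt_charP _ Ic) => chi' Nchi' ->; rewrite -phiE raddfD /=.
case/(constt_charP _ (cfInd_char G (lin_charW lin))): iphi => psi' Npsi' ->.
apply/constt_charP; first by rewrite !rpredD ?irr_char ?cfInd_char.
by exists (psi' + 'Ind[G] chi'); rewrite ?addrA // rpredD ?cfInd_char.
Qed.

Section Label.
Variable d : nat.
Local Notation N S := 'N(S | 'P)%g.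

(** A transposition of two common points reverses the summand. *)
Lemma sum_sign_perm_onI (X Z : {set 'I_d}) :
  \sum_(a : 'S_d | perm_on X a && perm_on Z a) (-1) ^+ odd_perm a =
    (#|X :&: Z| <= 1)%N%:R :> algC.
Proof.
have onI a : perm_on X a && perm_on Z a = perm_on (X :&: Z) a.
  apply/andP/idP => [[/subsetP aX /subsetP aZ]|aXZ].
    by apply/subsetP => x xa; rewrite inE aX ?aZ.
  by split; apply: (subset_trans aXZ); rewrite ?subsetIl ?subsetIr.
under eq_bigl do rewrite onI.
case: leqP => [XZ|/card_gt1P[a [b [aXZ bXZ ab]]]].
  rewrite (big_pred1 1%g) ?odd_perm1 // => a; apply/idP/eqP => [aon|->]; last exact: perm_on1.
  exact: perm_on_id aon XZ.
have ton : perm_on (X :&: Z) (tperm a b).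
  apply/subsetP => x; rewrite inE; apply: contraR => xXZ; rewrite tpermD //.
    by apply: contraNneq xXZ => <-.
  by apply: contraNneq xXZ => <-.
apply/eqP; rewrite -[_ == 0](mulrn_eq0 _ 2) //= mulr2n addr_eq0; apply/eqP.
rewrite {1}(reindex_inj (mulIg (tperm a b))) /= -sumrN.
apply: eq_big => [g|g _]; last by rewrite odd_permM odd_tperm ab addbT signrN.
apply/idP/idP => gon; last exact: perm_onM.
by rewrite -[g](mulgK (tperm a b)) perm_onM // perm_onV.
Qed.

(** Such a Z is the complement of X with one point of X added. *)
Lemma sum_set_transversal (X : {set 'I_d}) :
  (\sum_(Z : {set 'I_d} | #|Z| == (d - #|X|).+1) (#|X :&: Z| <= 1) = #|X|)%N.
Proof.
have cX : #|~: X| = (d - #|X|)%N by rewrite cardsCs setCK card_ord.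
have XI x : x \in X -> X :&: (x |: ~: X) = [set x].
  move=> xX; apply/setP => y; rewrite !inE.
  by case: eqP => [->|_]; rewrite ?xX //= andbN.
have inj : {in X &, injective (fun x => x |: ~: X)}.
  by move=> x y xX yX E; apply: set1_inj; rewrite -(XI x) // E XI.
rewrite -[RHS](card_in_imset inj) -[RHS]sum1_card big_mkcond [RHS]big_mkcond /=.
apply: eq_bigr => Z _; set b := (_ \in _); set c := (_ <= 1)%N; set e := _ == _.
suff -> : b = e && c by case: e; case: c.
rewrite {}/b {}/c {}/e; apply/imsetP/andP => [[x xX ->]|[/eqP cZ cXZ]].
  by rewrite XI // cards1 cardsU1 cX inE xX.
have ZD : Z :\: X = ~: X.
  apply/eqP; rewrite eqEcard {1}setDE subsetIr /=.
  have := cardsD Z X; rewrite cZ cX (setIC Z X) => ->.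
  by rewrite (leq_trans _ (leq_sub2l _ cXZ)) // subn1.
have /cards1P[x xE] : #|X :&: Z| == 1%N.
  have := cardsID X Z; rewrite ZD cX cZ (setIC Z X) => E.
  by rewrite -(eqn_add2r (d - #|X|)) E add1n.
exists x; first by have := set11 x; rewrite -xE inE => /andP[].
by rewrite -[LHS](setID Z X) ZD setIC xE.
Qed.

Lemma card_perm_on (X : {set 'I_d}) : #|[set g : 'S_d | perm_on X g]| = #|X|`!.
Proof. by rewrite -card_perm; apply: eq_card => g; rewrite inE. Qed.

Lemma perm_onJ (Y : {set 'I_d}) (a y : 'S_d) :
  perm_on (y @: Y) (a ^ y)%g = perm_on Y a.
Proof.
apply/subsetP/subsetP => H x; rewrite inE => ax.
  have := H (y x); rewrite inE permJ (inj_eq (@perm_inj _ y)) ax.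
  by rewrite (mem_imset _ _ (@perm_inj _ y)); apply.
rewrite -[x](permKV y) (mem_imset _ _ (@perm_inj _ y)) H // inE.
by move: ax; rewrite -{1 2}[x](permKV y) permJ (inj_eq (@perm_inj _ y)).
Qed.

(** Mackey: only the y for which y(Y) meets X in a single point contribute, each
    with 1, and there are |A| |B| of them. *)
Lemma Ind_perm_on_dot (A B : {group 'S_d}) (X Y : {set 'I_d}) :
    (forall g, (g \in A) = perm_on X g) -> (forall g, (g \in B) = perm_on Y g) ->
    (0 < #|X|)%N -> (#|X| + #|Y|)%N = d.+1 ->
  '['Ind[[set: 'S_d], A] 1, 'Ind[[set: 'S_d]] ('Res[B] (sign_char d))] = 1.
Proof.
move=> AE BE X0 XY.
have cA : #|A| = #|X|`! by rewrite -card_perm_on; apply: eq_card => g; rewrite inE AE.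
have cB : #|B| = #|Y|`! by rewrite -card_perm_on; apply: eq_card => g; rewrite inE BE.
rewrite -cfdot_Res_r cfdotE cA.
transitivity (#|X|`!%:R^-1 * (#|Y|`!%:R^-1 * (\sum_(y : 'S_d) (#|X :&: y @: Y| <= 1)%N%:R)) : algC).
  congr (_ * _); rewrite [in RHS](eq_bigr (fun y : 'S_d =>
    \sum_(a : 'S_d | perm_on X a && perm_on (y @: Y) a) (-1) ^+ odd_perm a)); last first.
    by move=> y _; rewrite sum_sign_perm_onI.
  rewrite (exchange_big_dep (fun a => perm_on X a)) /=; last by move=> y a _ /andP[].
  rewrite mulr_sumr; apply: eq_big => [a|a aA]; first by rewrite AE.
  rewrite cfun1E aA mul1r cfResE ?subsetT // cfIndE ?subsetT // cB.
  rewrite rmorphM fmorphV rmorph_nat rmorph_sum /=; congr (_ * _).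
  rewrite (reindex_inj invg_inj) /= [RHS]big_mkcond; apply: eq_big => [y|y _]; first by rewrite inE.
  have -> : perm_on (y @: Y) a = ((a ^ y^-1)%g \in B) by rewrite BE -(perm_onJ Y _ y) conjgKV.
  have [aB|aB] := boolP ((a ^ y^-1)%g \in B); last first.
    by rewrite cfun0 // rmorph0 andbF.
  by rewrite cfResE ?subsetT // cfunE odd_permJ rmorph_sign -AE aA.
rewrite (sum_set_stab Y (fun Z => (#|X :&: Z| <= 1)%N%:R)) -natr_sum.
have Xd : (#|X| <= d)%N by rewrite -[leqRHS](card_ord d) max_card.
have -> : #|Y| = (d - #|X|).+1 by lia.
rewrite sum_set_transversal (_ : (d - #|X|).+1 = #|Y|); last by lia.
have := card_stab Y.
have Yd : (#|Y| <= d)%N by lia.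
rewrite -(bin_fact Yd) mulnC => /eqP; rewrite eqn_pmul2l ?bin_gt0 // => /eqP ->.
rewrite (_ : (d - #|Y| = #|X|.-1)%N); last by lia.
rewrite -{1}(prednK X0) factS prednK // !natrM.
by field; rewrite ?pnatr_eq0 -?lt0n ?fact_gt0 //; lia.
Qed.
End Label.

(** An inner product 1 leaves room for a single common constituent. *)
Lemma constt_unique (gT : finGroupType) (G : {group gT}) (phi psi : 'CF(G)) i j :
    phi \is a character -> psi \is a character -> '[phi, psi] = 1 ->
    i \in irr_constt phi -> i \in irr_constt psi ->
    j \in irr_constt phi -> j \in irr_constt psi -> i = j.
Proof.
move=> Nphi Npsi; rewrite cfdot_char_r // => dot1 i1 i2 j1 j2.
have nat k : '[phi, 'chi_k] * '[psi, 'chi_k] \in Num.nat.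
  by rewrite rpredM // Cnat_cfdot_char_irr.
have [k [_ _ kU]] := natr_sum_eq1 (fun k _ => nat k) dot1.
have mem m : m \in irr_constt phi -> m \in irr_constt psi -> m = k.
  move=> m1 m2; apply/eqP/negPn/negP => mk.
  by have /eqP := kU m mk isT; rewrite mulf_eq0 (negbTE m1) (negbTE m2).
by rewrite (mem i) // (mem j).
Qed.

(** The hook character of index j occurs in both exterior powers j and j + 1,
    hence in the two induced characters that define the label of the hook, and
    these have no other constituent in common. *)
Lemma chi_index_hook d j : (j < d)%N ->
  'chi_(chi_index d (hook_part d j)) = hook_cfun d j.
Proof.
move=> jd; have [i hE] := hook_irr jd.
pose X := [set x : 'I_d | (x < d - j)%N]; pose Y := [set x : 'I_d | (x < j.+1)%N].
have cX : #|X| = (d - j)%N by rewrite card_ord_lt // leq_subr.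
have cY : #|Y| = j.+1 by rewrite card_ord_lt.
have AE g : (g \in young d (hook_part d j)) = perm_on X g by rewrite young_hookE // ltnW.
have BE g : (g \in young d (conj_part (hook_part d j))) = perm_on Y g.
  by rewrite conj_hook_part // young_hookE ?leq_subr // (_ : (d - (d - j.+1))%N = j.+1) //; lia.
have iA : i \in irr_constt ('Ind[[set: 'S_d], young d (hook_part d j)] 1).
  have cX' : #|~: X| = j by rewrite cardsCs setCK card_ord cX subKn // ltnW.
  have AN : young d (hook_part d j) \subset 'N(~: X | 'P)%g.
    apply/subsetP => g; rewrite AE stab_setE => gX; apply/eqP/setP => x.
    rewrite -{1}[x](permKV g) (mem_imset _ _ (@perm_inj _ g)) !inE.
    by have := perm_closed (g^-1 x)%g gX; rewrite permKV !inE => ->.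
  apply: (constt_Ind_sub AN (subsetT _) (set_sign_lin (~: X))).
    apply/cfun_inP => g gA; rewrite cfResE // cfun1E gA set_signE (subsetP AN) // /sgn_on.
    suff -> : restr_perm (~: X) g = 1%g by rewrite odd_perm1.
    apply/permP => x; rewrite perm1; have [xX|xX] := boolP (x \in ~: X).
      rewrite restr_permE ?(subsetP AN) //; rewrite AE in gA.
      by rewrite (out_perm gA) // -in_setC.
    by rewrite (out_perm (restr_perm_on _ _)).
  rewrite irr_consttE -ext_charS cX' -hE cfdotC hook_ext_dot ?(ltnW jd) // eqxx.
  by rewrite rmorph_nat pnatr_eq0.
have iB : i \in irr_constt ('Ind[[set: 'S_d]] ('Res[young d (conj_part (hook_part d j))] (sign_char d))).
  have BN : young d (conj_part (hook_part d j)) \subset 'N(Y | 'P)%g.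
    apply/subsetP => g; rewrite BE stab_setE => gY; apply/eqP/setP => x.
    rewrite -{1}[x](permKV g) (mem_imset _ _ (@perm_inj _ g)).
    by have := perm_closed (g^-1 x)%g gY; rewrite permKV => ->.
  apply: (constt_Ind_sub BN (subsetT _) (set_sign_lin Y)).
    apply/cfun_inP => g gB; rewrite !cfResE ?subsetT // set_signE (subsetP BN) // /sgn_on cfunE.
    suff -> : restr_perm Y g = g by [].
    apply/permP => x; have [xY|xY] := boolP (x \in Y); first by rewrite restr_permE ?(subsetP BN).
    by rewrite (out_perm (restr_perm_on _ _)) // (@out_perm _ Y) // -BE.
  rewrite irr_consttE -ext_charS cY -hE cfdotC hook_ext_dot // eqxx addn1.
  by rewrite rmorph_nat pnatr_eq0.
rewrite hE /chi_index; congr ('chi_ _).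
case: pickP => [k /andP[kA kB]|/(_ i)]; last by rewrite iA iB.
(* X and Y have d + 1 points in total. *)
have dot1 := Ind_perm_on_dot AE BE (_ : 0 < #|X|)%N (_ : #|X| + #|Y| = d.+1)%N.
apply: (constt_unique _ _ (dot1 _ _)) => //.
- by rewrite cfInd_char // rpred1.
- by rewrite cfInd_char // cfRes_char // lin_charW // sign_char_lin.
- by rewrite cX; lia.
- by rewrite cX cY; lia.
Qed.

(** * Counting factorizations with characters *)

Section Frobenius.
Variable gT : finGroupType.
Notation G := [set: gT].

(** A class function, as an element of the group algebra, acts on an
    irreducible representation by a scalar. *)
Lemma class_fun_conv (F : gT -> algC) (i : Iirr G) y :
    (forall x z, F (x ^ z)%g = F x) ->
  \sum_x F x * 'chi_i (x * y)%g = (\sum_x F x * 'chi_i x) / 'chi_i 1%g * 'chi_i y.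
Proof.
move=> FJ; have Fclass : is_class_fun <<G>>%g [ffun x => F x^-1%g].
  rewrite genGid; apply: intro_class_fun => [x z _ _|x]; last by rewrite inE.
  by rewrite -conjVg FJ.
pose F' : 'CF(G) := Cfun 0 Fclass.
have FE x : F x = F' x^-1%g by rewrite cfunE invgK.
have key z : \sum_x F x * 'chi_i (x * z)%g =
    #|G|%:R * '[F', 'chi_i] / 'chi_i 1%g * 'chi_i z.
  transitivity (\sum_x \sum_j '[F', 'chi_j] * ('chi_i (x * z)%g * 'chi_j x^-1%g)).
    apply: eq_bigr => x _; rewrite FE {1}[F']cfun_sum_cfdot sum_cfunE mulr_suml.
    by apply: eq_bigr => j _; rewrite cfunE -mulrA; congr (_ * _); rewrite mulrC.
  rewrite exchange_big (bigD1 i) //= [X in _ + X]big1 ?addr0 => [|j ji]; rewrite -mulr_sumr.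
    have := generalized_orthogonality_relation z i i; rewrite eqxx mul1r.
    move/(canRL (mulVKf (neq0CG _))); rewrite (eq_bigl xpredT) => [->|x]; last by rewrite inE.
    by ring.
  have := generalized_orthogonality_relation z i j; rewrite eq_sym (negbTE ji) mul0r.
  move/(canRL (mulVKf (neq0CG _))); rewrite (eq_bigl xpredT) => [->|x]; last by rewrite inE.
  by rewrite !mulr0.
rewrite key; congr (_ / _ * _); have := key 1%g.
under eq_bigr do rewrite mulg1.
by move=> ->; rewrite divfK ?irr1_neq0.
Qed.

Lemma indicator1_irr (x : gT) :
  (x == 1%g)%:R = #|G|%:R^-1 * \sum_(i : Iirr G) 'chi_i 1%g * 'chi_i x.
Proof.
have := cfRegE G x; rewrite cfReg_sum sum_cfunE; under eq_bigr do rewrite cfunE.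
by move=> ->; rewrite mulrnAr mulVf ?neq0CG.
Qed.
End Frobenius.

Section FactorizationCount.
Variable d : nat.

(** The scalar by which the sum of the class of type nu acts on the
    representation i. *)
Definition central_char (i : Iirr [set: 'S_d]) (nu : seq nat) : algC :=
  (\sum_(s in conj_class d nu) 'chi_i s) / 'chi_i 1%g.

Lemma cycle_typeJ (s t : 'S_d) : cycle_type (s ^ t)%g = cycle_type s.
Proof.
have poJ x : porbit (s ^ t)%g (t x) = t @: porbit s x.
  have tX k : ((s ^ t) ^+ k)%g (t x) = t ((s ^+ k)%g x) by rewrite -conjXg permJ.
  apply/setP => w; apply/porbitP/imsetP => [[k ->]|[v /porbitP[k ->] ->]].
    by exists ((s ^+ k)%g x); rewrite ?mem_porbit.
  by exists k; rewrite tX.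
have posJ : porbits (s ^ t)%g = (fun c : {set 'I_d} => t @: c) @: porbits s.
  apply/setP => c; apply/imsetP/imsetP => [[x _ ->]|[_ /imsetP[x _ ->] ->]].
    by exists (porbit s (t^-1 x)%g); rewrite ?imset_f // -poJ permKV.
  by exists (t x).
have inj : injective (fun c : {set 'I_d} => t @: c) := imset_inj (@perm_inj _ t).
apply/eqP; rewrite cycle_typeE ?cycle_type_partition // perm_sym.
apply: (perm_trans (perm_cycle_type s)); rewrite /cycle_lengths posJ.
have -> : [seq #|c| | c : {set 'I_d} <- enum (porbits s)] =
    [seq #|c| | c : {set 'I_d} <- [seq t @: c | c : {set 'I_d} <- enum (porbits s)]].
  by rewrite -map_comp; apply: eq_map => c /=; rewrite card_imset //; apply: perm_inj.
apply/perm_map/uniq_perm; rewrite ?map_inj_uniq ?enum_uniq // => c.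
by rewrite mem_enum; apply/mapP/imsetP => -[b bs ->]; exists b; rewrite ?mem_enum in bs *.
Qed.

Lemma sum_typed_tuples (i : Iirr [set: 'S_d]) nus y :
  \sum_(x : (size nus).-tuple 'S_d | map (@cycle_type d) x == nus)
     'chi_i ((\prod_(s <- x) s)%g * y)%g =
  (\prod_(nu <- nus) central_char i nu) * 'chi_i y.
Proof.
elim: nus y => [|nu nus IH] y.
  rewrite (big_pred1 [tuple]) => [|t]; last by rewrite tuple0 eqxx.
  by rewrite !big_nil mul1g mul1r.
rewrite big_cons -mulrA -IH mulr_sumr.
rewrite (reindex (fun p : (size nus).-tuple 'S_d * 'S_d => [tuple of p.2 :: p.1])) /=; last first.
  exists (fun t : (size nus).+1.-tuple 'S_d => ([tuple of behead t], thead t)) => [[t s] _|t _] /=.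
    by congr (_, _); apply: val_inj.
  by rewrite -tuple_eta.
have mulE z : central_char i nu * 'chi_i z = \sum_(s | cycle_type s == nu) 'chi_i (s * z)%g.
  have := class_fun_conv i z (F := fun s : 'S_d => (cycle_type s == nu)%:R).
  have mk (f : 'S_d -> algC) :
      \sum_x (cycle_type x == nu)%:R * f x = \sum_(x | cycle_type x == nu) f x.
    by rewrite [RHS]big_mkcond; apply: eq_bigr => x _; rewrite mulr_natl mulrb.
  rewrite !mk => ->; last by move=> s t; rewrite cycle_typeJ.
  by rewrite /central_char; congr (_ / _ * _); apply: eq_bigl => s; rewrite inE.
rewrite [RHS](eq_bigr _ (fun t _ => mulE _)) pair_big_dep /=.
apply: eq_big => [[t s]|[t s] _] /=; first by rewrite eqseq_cons andbC.
by rewrite big_cons mulgA.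
Qed.

(** Frobenius: the condition that the product is 1 is detected by the regular
    character. *)
Lemma num_factorizationsE nus :
  (num_factorizations d nus)%:R =
  d`!%:R^-1 * \sum_i 'chi[[set: 'S_d]]_i 1%g ^+ 2 * \prod_(nu <- nus) central_char i nu.
Proof.
rewrite /num_factorizations -sum1_card natr_sum.
transitivity (\sum_(x : (size nus).-tuple 'S_d | map (@cycle_type d) x == nus)
   ((\prod_(s <- x) s)%g == 1%g)%:R : algC).
  rewrite [LHS]big_mkcond [RHS]big_mkcond; apply: eq_bigr => x _.
  by rewrite inE andbC; case: (_ == nus); case: (_ == 1%g).
under eq_bigr do rewrite indicator1_irr.
rewrite -mulr_sumr cardsT card_Sn exchange_big /=; congr (_ * _); apply: eq_bigr => i _.
rewrite -mulr_sumr expr2 -mulrA; congr (_ * _); rewrite mulrC -sum_typed_tuples.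
by apply: eq_bigr => x _; rewrite mulg1.
Qed.

Lemma hurwitzE (kappa : nat -> seq nat -> algC) K mus :
  hurwitz kappa d K mus = d`!%:R^-1 ^+ 2 *
   \sum_i 'chi[[set: 'S_d]]_i 1%g ^+ 2 *
     (\prod_(k <- K) \sum_(e : partition_le d)
        kappa k e / k`!%:R * (up_mult d e)%:R * central_char i (up_part d e)) *
     \prod_(mu <- mus) central_char i mu.
Proof.
rewrite /hurwitz expr2 -[RHS]mulrA; congr (_ * _).
under eq_bigr do rewrite num_factorizationsE mulrCA mulr_sumr.
rewrite -mulr_sumr exchange_big /=; congr (_ * _); apply: eq_bigr => i _.
rewrite [in RHS](big_nth 0%N) big_mkord bigA_distr_bigA /=.
rewrite mulr_sumr mulr_suml.
rewrite (reindex (fun t : (size K).-tuple (partition_le d) => [ffun i => tnth t i])) /=; last first.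
  exists (fun f : {ffun 'I_(size K) -> partition_le d} => [tuple f i | i < size K]) => [t _|f _].
    by apply: eq_from_tnth => k; rewrite tnth_mktuple ffunE.
  by apply/ffunP => k; rewrite ffunE tnth_mktuple.
apply: eq_bigr => t _; rewrite big_cat big_map /= mulrCA -mulrA; congr (_ * _).
rewrite mulrA; congr (_ * _); rewrite big_tuple -big_split /=.
by apply: eq_bigr => k _; rewrite ffunE.
Qed.

(** * Characters that do not vanish on the long cycles *)

(** A permutation that commutes with a long cycle is determined by the image of
    one point. *)
Lemma card_cent_cycle (c : 'S_d) : (0 < d)%N -> perm_eq (cycle_lengths c) [:: d] ->
  (#|'C[c]%g| <= d)%N.
Proof.
move=> d0 cd; pose x0 := Ordinal d0.
have orb x : x \in porbit c x0.
  have : #|porbit c x0| \in cycle_lengths c.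
    by apply/mapP; exists (porbit c x0); rewrite // mem_enum imset_f.
  rewrite (perm_mem cd) mem_seq1 => /eqP dE.
  suff -> : porbit c x0 = setT by rewrite inE.
  by apply/eqP; rewrite eqEcard subsetT cardsT card_ord dE /=.
rewrite -[leqRHS]card_ord -(card_in_imset (f := fun w : 'S_d => w x0)) ?max_card //.
move=> w w' /cent1P cw /cent1P cw' ww'; apply/permP => x.
have /porbitP[k ->] := orb x.
have comm (v : 'S_d) : commute v c -> v ((c ^+ k)%g x0) = (c ^+ k)%g (v x0).
  by move=> vc; rewrite -!permM (commuteX _ vc).
by rewrite !comm ?ww' //; apply: commute_sym.
Qed.

Lemma hook_index_inj : injective (fun j : 'I_d => chi_index d (hook_part d j)).
Proof.
move=> j k E; have := hook_dot (ltn_ord j) (ltn_ord k).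
rewrite -!chi_index_hook // E cfnorm_irr => /eqP.
by rewrite eq_sym pnatr_eq1 eqb1 => /eqP/val_inj.
Qed.

(** The d hook characters already exhaust the second orthogonality relation at
    a long cycle. *)
Lemma irr_cycle_eq0 (c : 'S_d) i : (0 < d)%N -> perm_eq (cycle_lengths c) [:: d] ->
  (forall j : 'I_d, i != chi_index d (hook_part d j)) -> 'chi_i c = 0.
Proof.
move=> d0 cd ih.
have := second_orthogonality_relation c (in_setT c).
rewrite class_refl mulr1n => E.
pose H := [set chi_index d (hook_part d j) | j : 'I_d].
have nn k : 0 <= 'chi_k c * ('chi_k c)^* :> algC by rewrite mul_conjC_ge0.
have iH : i \notin H by apply/imsetP => -[j _ ij]; have := ih j; rewrite ij eqxx.
have HE : \sum_(k in H) 'chi_k c * ('chi_k c)^* = d%:R :> algC.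
  rewrite big_imset /=; last by move=> j k _ _; apply: hook_index_inj.
  rewrite (eq_bigr (fun=> 1)) ?sumr_const ?card_ord // => j _.
  by rewrite chi_index_hook // hook_cfun_cycle // rmorph_sign -expr2 sqrr_sign.
have : d%:R + 'chi_i c * ('chi_i c)^* <= d%:R :> algC.
  have cc : #|'C_[set: 'S_d][c]%g|%:R <= d%:R :> algC.
    by rewrite ler_nat setTI card_cent_cycle.
  apply: Order.POrderTheory.le_trans cc; rewrite -E -HE [X in _ <= X](bigID (mem H)) /= lerD2l.
  by rewrite (bigD1 i) //= lerDl sumr_ge0.
rewrite gerDl => le0; apply/eqP; rewrite -mul_conjC_eq0.
by apply/eqP/Order.POrderTheory.le_anti; rewrite le0 nn.
Qed.
End FactorizationCount.

(** * Completed cycles on hooks *)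

Lemma card_conj_class d la : is_partition la -> sumn la = d ->
  (#|conj_class d la| * z_part la)%N = d`!.
Proof.
move=> la_part lad; have /andP[_ la0] := la_part; rewrite -(num_of_type_z la0 lad).
congr (_ * _)%N; rewrite -sum1_card big_mkcond /num_of_type; apply: eq_bigr => s _.
by rewrite inE cycle_typeE //; case: perm_eq.
Qed.

Lemma conj_class_ex d la : is_partition la -> sumn la = d ->
  exists s, s \in conj_class d la.
Proof.
move=> la_part lad; apply/set0Pn; rewrite -card_gt0.
have : (0 < #|conj_class d la| * z_part la)%N.
  by rewrite card_conj_class // fact_gt0.
by rewrite muln_gt0 => /andP[].
Qed.

Lemma up_part_partition d eta : is_partition eta -> (sumn eta <= d)%N ->
  is_partition (up_part d eta) /\ sumn (up_part d eta) = d.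
Proof.
move=> /andP[srt e0] le; rewrite /up_part; split; last first.
  by rewrite sumn_cat sumn_nseq mul1n subnKC.
rewrite /is_partition mem_cat negb_or e0 mem_nseq andbF andbT.
have trg : transitive geq by move=> a b c; rewrite /geq /=; lia.
rewrite sorted_pairwise // pairwise_cat -!sorted_pairwise // srt /=; apply/andP; split.
  apply/allrelP => x y xe; rewrite mem_nseq => /andP[_ /eqP->]; rewrite /geq /= lt0n.
  by apply: contraNneq e0 => <-.
by elim: (d - sumn eta)%N => [|[|n] IH].
Qed.

Lemma z_part_up d eta :
  (z_part (up_part d eta) * (count_mem 1 eta)`! =
   z_part eta * (count_mem 1 eta + (d - sumn eta))`!)%N.
Proof.
have pE : perm_eq (up_part d eta) (nseq (d - sumn eta) 1%N ++ eta) by rewrite perm_catC.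
rewrite (perm_z_part pE); elim: (d - sumn eta)%N => [|n IH]; first by rewrite addn0.
rewrite /= z_part_cons addnS factS count_cat count_nseq /= mul1n mul1n.
by rewrite mulnAC IH (addnC n); ring.
Qed.

(** Both sides are d! / ((d - |eta|)! z_eta). *)
Lemma class_up d eta : is_partition eta -> (sumn eta <= d)%N ->
  ('C(d, sumn eta) * #|conj_class (sumn eta) eta| =
   up_mult d eta * #|conj_class d (up_part d eta)|)%N.
Proof.
move=> ep le; have [upp upd] := up_part_partition ep le; have /andP[_ e0] := ep.
have H1 := card_conj_class ep erefl; have H2 := card_conj_class upp upd.
have H3 := z_part_up d eta; have H4 := bin_fact le.
set m1 := count_mem 1%N eta in H3 *; set k := (d - sumn eta)%N in H3 H4 *.
have cE : count_mem 1%N (up_part d eta) = (m1 + k)%N.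
  by rewrite count_cat count_nseq /= mul1n.
rewrite /up_mult cE -/m1.
have H5 := bin_fact (leq_addr k m1); rewrite addKn in H5.
have pos : (0 < z_part eta * (m1`! * k`!))%N.
  by rewrite muln_gt0 z_part_gt0 // muln_gt0 !fact_gt0.
apply/eqP; rewrite -(eqn_pmul2r pos); apply/eqP.
transitivity (d`! * m1`!)%N; first by rewrite -H4 -H1; ring.
transitivity (#|conj_class d (up_part d eta)| * (z_part eta * (m1 + k)`!))%N; last by rewrite -H5; ring.
by rewrite -H3 mulnA H2.
Qed.

Lemma cycle_type1 d (s : 'S_d) : (cycle_type s == nseq d 1%N) = (s == 1%g).
Proof.
have P1 : is_partition (nseq d 1%N).
  rewrite /is_partition mem_nseq andbF andbT.
  by elim: d {s} => [|[|n] IH].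
have c1 : cycle_type (1%g : 'S_d) == nseq d 1%N.
  rewrite cycle_typeE // /cycle_lengths.
  have -> : porbits (1%g : 'S_d) = [set [set x] | x : 'I_d].
    by apply: eq_imset => x; rewrite porbit_fix ?perm1.
  have /all_pred1P -> : all (pred1 1%N) [seq #|c| | c : {set 'I_d} <- enum [set [set x] | x : 'I_d]].
    by apply/allP => e /mapP[c]; rewrite mem_enum => /imsetP[x _ ->] ->; rewrite /= cards1.
  rewrite size_map -cardE (_ : #|_| = d) //.
  by rewrite (card_imset _ (@set1_inj 'I_d)) card_ord.
apply/idP/eqP => [|-> //]; rewrite cycle_typeE // => /perm_mem sE.
apply/permP => x; rewrite perm1.
have : #|porbit s x| \in cycle_lengths s.
  by apply/mapP; exists (porbit s x); rewrite // mem_enum imset_f.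
rewrite sE mem_nseq => /andP[_ /eqP/esym/eqP]; rewrite eq_sym => /cards1P[y yE].
have := porbit_id s x; have := mem_porbit s 1 x; rewrite expg1 yE !inE => /eqP -> /eqP ->.
by [].
Qed.

Lemma partition_leP d (e : partition_le d) : is_partition e /\ (sumn e <= d)%N.
Proof. exact/andP/(valP e). Qed.

Section HookEigen.
Variables (kappa : nat -> seq nat -> algC) (kappaP : p_expansion kappa).

Lemma p_expansion_size d k la : (0 < k)%N -> is_partition la -> sumn la = d ->
  p_shifted k la = \sum_(eta : partition_le d) kappa k eta * f_shifted eta la.
Proof. by move=> k0 lap <-; apply: kappaP. Qed.

Lemma chi_atE d la mu : sumn la = d ->
  chi_at la mu = if [pick s | s \in conj_class d mu] is Some s then 'chi_(chi_index d la) s else 0.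
Proof. by move=> <-. Qed.

Lemma chi_dimE d la : sumn la = d -> chi_dim la = 'chi_(chi_index d la) 1%g.
Proof. by move=> <-. Qed.

Lemma hook_part_partition d j : (j < d)%N ->
  is_partition (hook_part d j) /\ sumn (hook_part d j) = d.
Proof.
move=> jd; rewrite /hook_part /= sumn_nseq mul1n subnK 1?ltnW //; split=> //.
rewrite /is_partition inE negb_or mem_nseq andbF andbT eq_sym subn_eq0 -ltnNge jd andbT /=.
by case: j jd => //= j jd; rewrite /geq /= subn_gt0 jd; elim: j {jd} => //= j ->; case: j.
Qed.

Lemma central_char_hook d j mu s : (j < d)%N -> is_partition mu ->
    s \in conj_class d mu ->
  central_char (chi_index d (hook_part d j)) mu =
    #|conj_class d mu|%:R * hook_cfun d j s / hook_cfun d j 1%g.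
Proof.
move=> jd mup; rewrite inE cycle_typeE // => sm; rewrite /central_char chi_index_hook //.
congr (_ / _); rewrite (eq_bigr (fun=> hook_cfun d j s)) ?sumr_const ?mulr_natl // => t.
by rewrite inE cycle_typeE // => tm; apply: eq_hook_cfun => //; rewrite (permPl tm) perm_sym.
Qed.

(** The completed cycles act by p_k because the classes of permutations of |eta|
    points, counted with up_mult, become the ones of d points (class_up). *)
Lemma p_shifted_central d j k : (0 < k)%N -> (j < d)%N ->
  \sum_(e : partition_le d)
     kappa k e / k`!%:R * (up_mult d e)%:R
     * central_char (chi_index d (hook_part d j)) (up_part d e)
  = p_shifted k (hook_part d j) / k`!%:R.
Proof.
move=> k0 jd; have [lap lad] := hook_part_partition jd.
rewrite (p_expansion_size k0 lap lad) mulr_suml; apply: eq_bigr => e' _; set e : partition_le d := e'.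
transitivity (kappa k e * ((up_mult d e)%:R *
    central_char (chi_index d (hook_part d j)) (up_part d e)) / k`!%:R); first by ring.
congr (_ * _ / _).
have [ep el] := partition_leP e.
have [upp upd] := up_part_partition ep el.
rewrite /f_shifted lad ltnNge el /= (chi_atE _ lad) (chi_dimE lad).
case: eqP => [e0|_].
  rewrite /up_mult /up_part e0 /= bin0 mul1r subn0 /central_char.
  rewrite (big_pred1 1%g) ?divff ?irr1_neq0 // => s.
  by rewrite inE cycle_type1.
rewrite -[in RHS]natrM class_up // natrM.
case: pickP => [s sP|none]; last first.
  have -> : central_char (chi_index d (hook_part d j)) (up_part d e) = 0.
    by rewrite /central_char big_pred0 ?mul0r.
  by rewrite !mulr0 mul0r.
rewrite (central_char_hook jd upp sP) -!mulrA; congr (_ * (_ * _)).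
by rewrite chi_index_hook.
Qed.
End HookEigen.

(** The terms of the parts 1 telescope. *)
Lemma p_shifted_hook k d j : (j < d)%N ->
  p_shifted k (hook_part d j) =
    (d%:R - j%:R - 2^-1) ^+ k - (- j%:R - 2^-1) ^+ k.
Proof.
move=> jd; rewrite /p_shifted /= size_nseq big_ord_recl /= natrB 1?ltnW //.
pose a i : algC := (- i%:R - 2^-1) ^+ k.
transitivity ((d%:R - j%:R - 2^-1) ^+ k - a 0%N + \sum_(0 <= i < j) (a i - a i.+1)).
  congr (_ - _ + _).
  - by congr (_ ^+ _); field.
  - by rewrite /a; congr (_ ^+ _); field.
  rewrite big_mkord; apply: eq_bigr => i _; rewrite /bump /= add1n nth_nseq ltn_ord /a.
  by congr (_ ^+ _ - _ ^+ _); rewrite -!natr1; field.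
rewrite (eq_bigr (fun i => - (a i.+1 - a i))) => [|i _]; last by rewrite opprB.
by rewrite sumrN telescope_sumr // opprB addrA subrK.
Qed.

(** This is (-1)^j times the value at cycle type beta of the hook character j:
    the coefficients of prod (1 - X^k) / (1 - X). *)
Definition signed_hook_value (beta : seq nat) (j : nat) : algC :=
  \sum_(i < j.+1) (\prod_(k <- beta) (1 - 'X^k) : {poly algC})`_i.

Lemma ones_of_size (nu : seq nat) : 0%N \notin nu -> sumn nu = size nu -> nu = nseq (size nu) 1%N.
Proof.
have szle (s : seq nat) : 0%N \notin s -> (size s <= sumn s)%N.
  by elim: s => //= a s IH; rewrite inE negb_or => /andP[a0 /IH]; lia.
elim: nu => //= a nu IH; rewrite inE negb_or => /andP[a0 nu0] E.
have := szle _ nu0 => le; have a1 : a = 1%N by lia.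
by rewrite a1 -IH //; lia.
Qed.

Lemma one_part_partition d : (0 < d)%N -> is_partition [:: d].
Proof. by move=> d0; rewrite /is_partition inE /= ltn_eqF. Qed.

(** Only the hooks survive, and at a hook every factor is explicit. *)
Lemma hurwitz_hook_sum kappa d K beta :
    p_expansion kappa -> all (leq 1) K -> (0 < d)%N ->
    is_partition beta -> sumn beta = d ->
  hurwitz_m kappa d d K [:: [:: d]; beta] =
  (d%:R * (z_part beta)%:R)^-1 * \sum_(j < d) signed_hook_value beta j *
     \prod_(k <- K) (((d%:R - j%:R - 2^-1) ^+ k - (- j%:R - 2^-1) ^+ k) / k`!%:R).
Proof.
move=> kappaP Kpos d0 bp bd; rewrite /hurwitz_m.
(* Of the partitions of d only 1^d has d parts. *)
have ones_p : nseq d 1%N \in codom (@parts d).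
  rewrite codom_parts sumn_nseq mul1n leqnn andbT /is_partition mem_nseq andbF andbT.
  by elim: (d) => [|[|n] IH].
have [x0 x0E] := codomP ones_p.
rewrite (big_pred1 x0) => [|x]; last first.
  apply/andP/eqP => [[/eqP xd /eqP xs]|->]; last by rewrite -x0E sumn_nseq size_nseq mul1n.
  apply: (@parts_inj d); rewrite -x0E -[in RHS]xs; apply: ones_of_size; last by rewrite xd xs.
  by have [/andP[]] := partition_leP x.
rewrite -x0E /= hurwitzE.
have dp := one_part_partition d0.
have dC : (#|conj_class d [:: d]| * d = d`!)%N.
  have := card_conj_class dp (addn0 d); rewrite /z_part /aut_part /= !big_seq1 /=.
  by rewrite eqxx addn0 mul1n.
have [c cd] := conj_class_ex dp (addn0 d).
have bC := card_conj_class bp bd.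
have [s sb] := conj_class_ex bp bd.
rewrite (bigID (mem [set chi_index d (hook_part d j) | j : 'I_d])) /=.
rewrite [X in _ + X]big1 ?addr0 => [|i iH]; last first.
  rewrite !big_cons (_ : central_char i [:: d] = 0) ?mul0r ?mulr0 //.
  rewrite /central_char big1 ?mul0r // => t; rewrite inE cycle_typeE // => td.
  apply: (irr_cycle_eq0 d0 td) => j; apply: contraNneq iH => ->; exact: imset_f.
rewrite big_imset /=; last by move=> j k _ _; apply: hook_index_inj.
rewrite !mulr_sumr; apply: eq_bigr => j _.
have -> : \prod_(k <- K) (\sum_(e : partition_le d) kappa k e / k`!%:R * (up_mult d e)%:R *
     central_char (chi_index d (hook_part d j)) (up_part d e)) =
  \prod_(k <- K) (((d%:R - j%:R - 2^-1) ^+ k - (- j%:R - 2^-1) ^+ k) / k`!%:R).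
  rewrite !big_seq; apply: eq_bigr => k kK.
  rewrite (p_shifted_central kappaP) ?p_shifted_hook //; exact: (allP Kpos).
rewrite !big_cons big_nil mulr1 (central_char_hook _ dp cd) // (central_char_hook _ bp sb) //.
have -> : central_char (chi_index d (hook_part d j)) (nseq d 1%N) = 1.
  rewrite /central_char (big_pred1 1%g) ?divff ?irr1_neq0 // => t.
  by rewrite inE cycle_type1.
rewrite mulr1 hook_cfun_cycle //; last by move: cd; rewrite inE cycle_typeE.
have -> : signed_hook_value beta j = (-1) ^+ j * hook_cfun d j s.
  rewrite hook_cfun_coef // /signed_hook_value; apply: eq_bigr => i _.
  by move: sb; rewrite inE cycle_typeE // => /(perm_big beta) ->.
have hE := chi_index_hook (ltn_ord j).
have h1 : hook_cfun d j 1%g != 0 by rewrite -hE irr1_neq0.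
rewrite hE; set w := \prod_(k <- K) _.
have f0 : d`!%:R != 0 :> algC by rewrite pnatr_eq0 -lt0n fact_gt0.
have dn0 : d%:R != 0 :> algC by rewrite pnatr_eq0 -lt0n.
have z0 : (z_part beta)%:R != 0 :> algC by rewrite pnatr_eq0 -lt0n z_part_gt0 //; case/andP: bp.
have -> : #|conj_class d [:: d]|%:R = d`!%:R / d%:R :> algC by rewrite -dC natrM mulfK.
have -> : #|conj_class d beta|%:R = d`!%:R / (z_part beta)%:R :> algC by rewrite -bC natrM mulfK.
by field; rewrite h1 f0 dn0 z0.
Qed.

(** * Truncated power series *)

Section TruncatedSeries.
Variable R : numFieldType.
Implicit Types p q A E : {poly R}.

Local Notation trunc N := (in_qpoly ('X^(N.+1) : {poly R})).

Lemma truncP N p q : trunc N p = trunc N q <-> forall i, (i <= N)%N -> p`_i = q`_i.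
Proof.
have vE r : val (trunc N r) = Pdiv.Ring.rmodp r 'X^(N.+1).
  by rewrite /in_qpoly /= mk_monic_Xn.
have dE r := Pdiv.RingMonic.rdivp_eq (monicXn R N.+1) r.
split=> [E i iN|E].
  have /(congr1 val) := E; rewrite !vE => M.
  by rewrite (dE p) (dE q) !coefD !coefMXn ltnS iN !add0r M.
have -> : p = q + drop_poly N.+1 (p - q) * 'X^(N.+1).
  apply/polyP => i; rewrite coefD coefMXn coef_drop_poly coefB.
  by case: leqP => iN; [rewrite subnK // addrC subrK | rewrite addr0 E].
rewrite rmorphD rmorphM /=.
have -> : trunc N 'X^(N.+1) = 0.
  by apply: val_inj; rewrite vE Pdiv.RingMonic.rmodpp ?monicXn.
by rewrite mulr0 addr0.
Qed.

(** E is the exponential of A: the differential equation E' = A' E, required up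
    to degree N, determines E up to degree N + 1. *)
Definition is_exp N A E := E`_0 = 1 /\ trunc N E^`() = trunc N (A^`() * E).

Lemma is_exp_uniq N A E F : is_exp N A E -> is_exp N A F ->
  trunc N.+1 E = trunc N.+1 F.
Proof.
move=> [E0 /truncP EE] [F0 /truncP FE]; apply/truncP.
elim/ltn_ind=> -[|i] IH iN; first by rewrite E0 F0.
have := EE i iN; have := FE i iN; rewrite !coef_deriv !coefM => F1 E1.
have : E`_i.+1 *+ i.+1 = F`_i.+1 *+ i.+1.
  rewrite E1 F1; apply: eq_bigr => k _; rewrite IH // ?ltnS ?leq_subr //.
  by rewrite (leq_trans (leq_subr _ _)) // (leq_trans (ltnW iN)).
by move/eqP; rewrite eqrMn2r //= => /eqP.
Qed.

Lemma is_exp_congr N A B E : trunc N A^`() = trunc N B^`() -> is_exp N A E -> is_exp N B E.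
Proof. by move=> AB [E0 EE]; split; rewrite // EE !rmorphM /= AB. Qed.

Lemma is_expM N A B E F : is_exp N A E -> is_exp N B F -> is_exp N (A + B) (E * F).
Proof.
move=> [E0 EE] [F0 FE]; split; first by rewrite coef0M E0 F0 mulr1.
by rewrite derivM derivD !rmorphD !rmorphM /= EE FE rmorphD !rmorphM /=; ring.
Qed.

Lemma is_exp_prod N (I : Type) (s : seq I) (A E : I -> {poly R}) :
    (forall i, is_exp N (A i) (E i)) ->
  is_exp N (\sum_(i <- s) A i) (\prod_(i <- s) E i).
Proof.
move=> H; elim: s => [|i s IH]; last by rewrite !big_cons; apply: is_expM.
by rewrite !big_nil; split; rewrite ?coef1 // derivC deriv0 mul0r.
Qed.

Lemma coef_comp_scaleX p c i : (p \Po (c *: 'X))`_i = c ^+ i * p`_i.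
Proof.
rewrite comp_polyE coef_sum.
have [ip|ip] := ltnP i (size p).
  rewrite (bigD1 (Ordinal ip)) //= exprZn coefZ coefZ coefXn eqxx mulr1 mulrC.
  rewrite big1 ?addr0 // => k ki; rewrite exprZn coefZ coefZ coefXn.
  by rewrite (_ : i == k = false) ?mulr0 //; apply: contraNF ki => /eqP ik; apply/eqP/val_inj.
rewrite (nth_default _ ip) mulr0 big1 // => k _; rewrite exprZn coefZ coefZ coefXn.
by rewrite gtn_eqF ?mulr0 // (leq_trans (ltn_ord k)).
Qed.

Lemma is_exp_scale N A E c : is_exp N A E -> is_exp N (A \Po (c *: 'X)) (E \Po (c *: 'X)).
Proof.
move=> [E0 /truncP EE]; split; first by rewrite coef_comp_scaleX expr0 mul1r.
rewrite !deriv_comp derivZ derivX mulrAC -comp_polyM [LHS]rmorphM [RHS]rmorphM /=.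
congr (_ * _); apply/truncP => i iN.
by rewrite !coef_comp_scaleX EE.
Qed.

(** The derivative of the truncated logarithm is r' times a truncated geometric
    series, which inverts r up to a power of r - 1 of order > N. *)
Lemma is_exp_log N (r : {poly R}) : r`_0 = 1 ->
  is_exp N (\sum_(1 <= k < N.+2) ((-1) ^+ k.+1 / k%:R) *: (r - 1) ^+ k) r.
Proof.
move=> r0; split=> //; set g := r - 1.
have rE : r = 1 + g by rewrite /g addrC subrK.
have dE : (\sum_(1 <= k < N.+2) ((-1) ^+ k.+1 / k%:R) *: g ^+ k)^`() =
    (\sum_(k < N.+1) (- g) ^+ k) * g^`().
  rewrite big_add1 big_mkord raddf_sum mulr_suml; apply: eq_bigr => k _ /=.
  rewrite derivZ deriv_exp /= -scaler_nat scalerA divfK ?pnatr_eq0 //.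
  by rewrite !exprS -mul_polyC !polyCM polyC_exp polyCN polyC1 (exprNn g); ring.
have g0 : g`_0 = 0 by rewrite coefB coef1 r0 subrr.
have gN : trunc N (g ^+ N.+1) = 0.
  have /factor_theorem[h hE] : root g 0 by rewrite rootE horner_coef0 g0.
  rewrite hE subr0 exprMn rmorphM /=.
  have -> : trunc N 'X^(N.+1) = 0.
    apply/eqP; rewrite -(rmorph0 (trunc N)); apply/eqP/truncP => i iN.
    by rewrite coefXn ltn_eqF // coef0.
  by rewrite mulr0.
have geo := subrX1 (- g) N.+1.
have key : trunc N (r * \sum_(k < N.+1) (- g) ^+ k) = 1.
  have -> : r * \sum_(k < N.+1) (- g) ^+ k = 1 - (- g) ^+ N.+1.
    by rewrite -opprB geo rE; ring.
  by rewrite rmorphB rmorph1 exprNn rmorphM /= gN mulr0 subr0.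
have -> : r^`() = g^`() by rewrite derivB derivC subr0.
rewrite dE -[LHS]mul1r -key -rmorphM; congr (trunc N _); ring.
Qed.

Definition exp_poly N (c : R) : {poly R} := \poly_(i < N.+2) (c ^+ i / i`!%:R).

Lemma is_exp_exp_poly N c : is_exp N (c *: 'X) (exp_poly N c).
Proof.
split; first by rewrite coef_poly /= expr0 fact0 divr1.
apply/truncP => i iN; rewrite derivZ derivX coef_deriv -scalerAl mul1r coefZ !coef_poly !ltnS iN.
rewrite (leq_trans iN) // factS natrM exprS -mulr_natr.
by field; rewrite pnatr_eq0 -lt0n fact_gt0 nat1r pnatr_eq0.
Qed.

Lemma exp_polyD N a b :
  trunc N.+1 (exp_poly N (a + b)) = trunc N.+1 (exp_poly N a * exp_poly N b).
Proof.
apply: is_exp_uniq (is_exp_exp_poly N (a + b)) _.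
by rewrite scalerDl; apply: is_expM; apply: is_exp_exp_poly.
Qed.

Lemma exp_poly0 N : exp_poly N 0 = 1.
Proof.
apply/polyP => i; rewrite coef_poly coef1 expr0n; case: eqP => [->|_]; last by rewrite mul0r if_same.
by rewrite fact0 divr1.
Qed.

End TruncatedSeries.

(** * The exponential of a series as a sum over partitions *)

Definition partitions n : seq (seq nat) := [seq s <- codom (@parts n) | sumn s == n].

Lemma mem_partitions n s : (s \in partitions n) = is_partition s && (sumn s == n).
Proof.
rewrite mem_filter codom_parts andbC; case: (is_partition s) => //=.
by case: eqP => [->|]; rewrite ?leqnn ?andbF ?andbT.
Qed.

Lemma partitions_uniq n : uniq (partitions n).
Proof. by rewrite filter_uniq // map_inj_uniq ?enum_uniq //; apply: parts_inj. Qed.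

Lemma big_partition_le (V : nmodType) D n (F : seq nat -> V) : (n <= D)%N ->
  \sum_(x : partition_le D | sumn x == n) F x = \sum_(s <- partitions n) F s.
Proof.
move=> nD; transitivity (\sum_(s <- codom (@parts D) | sumn s == n) F s).
  by rewrite big_map big_enum_cond.
rewrite -big_filter; apply: perm_big; apply: uniq_perm.
- by rewrite filter_uniq // map_inj_uniq ?enum_uniq //; apply: parts_inj.
- exact: partitions_uniq.
move=> s; rewrite mem_partitions mem_filter codom_parts andbC.
by case: (is_partition s) => //=; case: eqP => [->|]; rewrite ?nD ?andbF.
Qed.

Lemma perm_rem_partitions n k : (0 < k)%N -> (k <= n)%N ->
  perm_eq [seq rem k s | s <- partitions n & k \in s] (partitions (n - k)%N).
Proof.
move=> k0 kn; have srt : forall s : seq nat, sorted geq (sort geq s).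
  by move=> s; apply: sort_sorted => x y; rewrite /geq /= leq_total.
have trg : transitive geq by move=> x y z; rewrite /geq /=; lia.
apply: uniq_perm; last first.
- move=> t; rewrite mem_partitions; apply/mapP/andP => [[s]|[/andP[ts t0] /eqP tn]].
    rewrite mem_filter mem_partitions => /and3P[ks /andP[ss s0] /eqP sn] ->; split.
      rewrite /is_partition (subseq_sorted trg (rem_subseq k s)) //=.
      by apply: contra s0; apply: mem_rem.
    by rewrite -sn (perm_sumn (perm_to_rem ks)) /= addKn.
  have pE : perm_eq (sort geq (k :: t)) (k :: t) by rewrite perm_sort.
  have ks : k \in sort geq (k :: t) by rewrite (perm_mem pE) mem_head.
  exists (sort geq (k :: t)).
    rewrite mem_filter ks mem_partitions /is_partition srt (perm_mem pE) inE negb_or t0.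
    by rewrite (perm_sumn pE) /= tn subnKC // eqxx ltn_eqF.
  apply: sorted_geq_perm_eq => //; first exact: (subseq_sorted trg (rem_subseq _ _)).
  rewrite -(perm_cons k) perm_sym; apply: perm_trans pE.
  by rewrite perm_sym perm_to_rem.
- exact: partitions_uniq.
rewrite map_inj_in_uniq => [|s t]; first exact: filter_uniq (partitions_uniq n).
rewrite mem_filter mem_partitions => /and3P[ks /andP[ss _] _].
rewrite mem_filter mem_partitions => /and3P[kt /andP[st _] _] E.
apply: sorted_geq_perm_eq => //.
by rewrite (permPl (perm_to_rem ks)) (permPr (perm_to_rem kt)) E.
Qed.

Section PartitionSum.
Variables (R : numFieldType) (a : nat -> R).

Definition partition_sum n : R :=
  \sum_(s <- partitions n) (\prod_(j <- s) a j) / (aut_part s)%:R.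

Lemma partition_sum0 : partition_sum 0 = 1.
Proof.
rewrite /partition_sum (_ : partitions 0 = [:: [::]]) ?big_seq1.
  by rewrite /aut_part !big_nil divr1.
apply: perm_small_eq => //; apply: uniq_perm => //; first exact: partitions_uniq.
move=> s; rewrite mem_partitions inE; apply/andP/eqP => [[/andP[_ s0] /eqP]|-> //].
by case: s s0 => //= k s; rewrite inE negb_or => /andP[]; lia.
Qed.

(** Count the pairs of a partition and one of its parts; removing the part
    divides the order of the automorphism group by its multiplicity. *)
Lemma partition_sum_rec n :
  n%:R * partition_sum n = \sum_(1 <= k < n.+1) k%:R * a k * partition_sum (n - k)%N.
Proof.
pose w s := (\prod_(j <- s) a j) / (aut_part s)%:R.
transitivity (\sum_(s <- partitions n) \sum_(1 <= k < n.+1 | k \in s)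
   (k * count_mem k s)%N%:R * w s).
  rewrite mulr_sumr; apply: eq_big_seq => s; rewrite mem_partitions => /andP[/andP[_ s0] /eqP sn].
  rewrite -mulr_suml -natr_sum; congr (_%:R * _).
  rewrite -[LHS]sn -sum_count_undup -[RHS]big_filter; apply: perm_big.
  apply: uniq_perm; rewrite ?undup_uniq ?filter_uniq ?iota_uniq // => k.
  rewrite mem_undup mem_filter mem_index_iota; case: (boolP (k \in s)) => //= ks.
  rewrite lt0n ltnS -sn (perm_sumn (perm_to_rem ks)) /= leq_addr andbT; apply/esym.
  by apply: contraNneq s0 => <-.
rewrite (exchange_big_dep xpredT) //=.
rewrite [LHS]big_nat_cond [RHS]big_nat_cond; apply: eq_bigr => k; rewrite andbT => /andP[k0 kn].
rewrite [X in _ = _ * X]/partition_sum -(perm_big _ (perm_rem_partitions k0 kn)) big_map big_filter mulr_sumr.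
apply: eq_bigr => s ks; rewrite /w natrM (perm_aut_part (perm_to_rem ks)) aut_part_cons.
rewrite (perm_big _ (perm_to_rem ks)) big_cons (seq.permP (perm_to_rem ks)) /= eqxx add1n natrM.
by field; rewrite nat1r !pnatr_eq0 -lt0n aut_part_gt0.
Qed.

Lemma is_exp_partition_sum N :
  is_exp N (\poly_(i < N.+2) a i) (\poly_(i < N.+2) partition_sum i).
Proof.
split; first by rewrite coef_poly /= partition_sum0.
apply/truncP => i iN; rewrite coef_deriv coef_poly !ltnS iN -[LHS]mulr_natl.
rewrite partition_sum_rec big_add1 big_mkord coefM; apply: eq_bigr => k _.
have ki : (k <= N)%N by rewrite (leq_trans _ iN) // -ltnS.
rewrite coef_deriv !coef_poly !ltnS ki subSS (leq_trans (leq_subr _ _)) 1?ltnW //.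
by rewrite -[a k.+1 *+ k.+1]mulr_natl.
Qed.
End PartitionSum.

(** * Multivariate series as truncated polynomials *)

Section Lift.
Variable n : nat.
Implicit Types (m : 'X_{1..n}) (P : {mpoly algC[n]}) (q : {poly algC}).

Definition in_var (i : 'I_n) q : {mpoly algC[n]} := (map_poly (@mpolyC n algC) q).['X_i].

Lemma in_varE i q N : (size q <= N)%N -> in_var i q = \sum_(k < N) q`_k *: 'X_i ^+ k.
Proof.
move=> qN; rewrite /in_var (horner_coef_wide _ (leq_trans (size_poly _ _) qN)).
by apply: eq_bigr => k _; rewrite coef_map /= mul_mpolyC.
Qed.

Lemma in_varM i p q : in_var i (p * q) = in_var i p * in_var i q.
Proof. by rewrite /in_var rmorphM hornerM. Qed.

Lemma in_varX i p k : in_var i (p ^+ k) = in_var i p ^+ k.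
Proof. by rewrite /in_var rmorphXn horner_exp. Qed.

Lemma mcoeffMXn P i j m :
  (P * 'X_i ^+ j)@_m = if (j <= m i)%N then P@_(m - U_(i) *+ j) else 0.
Proof.
rewrite mpolyXn; case: leqP => jm.
  have {1}-> : m = (U_(i) *+ j + (m - U_(i) *+ j))%MM.
    apply/mnmP => k; rewrite mnmDE mnmBE mulmnE mnm1E.
    by case: eqP => [<-|_]; rewrite ?mul1n ?subnKC // mul0n subn0.
  by rewrite mcoeffMX.
rewrite mcoeffM big1 // => -[k1 k2] /= /eqP mE; rewrite mcoeffX.
case: eqP => [kE|_]; last by rewrite mulr0.
have /(congr1 (fun m' : 'X_{1..n} => m' i)) mi := mE.
by move: jm; rewrite mi mnmDE -kE mulmnE mnm1E eqxx mul1n ltnNge leq_addl.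
Qed.

Lemma mcoeff_in_varM P i q m :
  (P * in_var i q)@_m = \sum_(j < (m i).+1) P@_(m - U_(i) *+ j) * q`_j.
Proof.
rewrite (@in_varE i q (maxn (size q) (m i).+1)) ?leq_maxl // mulr_sumr raddf_sum /=.
rewrite (eq_bigr (fun j : 'I__ => if (j < (m i).+1)%N then P@_(m - U_(i) *+ j) * q`_j else 0)).
  by rewrite -big_mkcond (big_ord_widen_cond _ xpredT (fun j => P@_(m - U_(i) *+ j) * q`_j) (leq_maxr (size q) _)).
move=> j _; rewrite -scalerAr mcoeffZ mcoeffMXn ltnS.
by case: ifP; rewrite ?mulr0 // mulrC.
Qed.

Lemma mcoeff_in_var i q m :
  (in_var i q)@_m = if m == (U_(i) *+ m i)%MM then q`_(m i) else 0.
Proof.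
rewrite -[in_var i q]mul1r mcoeff_in_varM big_ord_recr /= big1 ?add0r => [|j _].
  rewrite mcoeff1; have -> : (m - U_(i) *+ m i == 0)%MM = (m == U_(i) *+ m i)%MM.
    apply/eqP/eqP => [/mnmP E|E]; last first.
      by apply/mnmP => k; rewrite mnmBE {1}E mnm0E subnn.
    apply/mnmP => k; have := E k; rewrite mnmBE mnm0E mulmnE mnm1E.
    by case: eqP => [->|_]; rewrite ?mul1n // mul0n subn0.
  by case: ifP; rewrite ?mul1r ?mul0r.
rewrite mcoeff1; case: eqP => [/mnmP/(_ i)|_]; last by rewrite mul0r.
rewrite mnmBE mulmnE mnm1E eqxx mul1n mnm0E => /eqP; rewrite subn_eq0 leqNgt.
by rewrite ltn_ord.
Qed.

(** The product of series is that of {mpoly algC[n]} read on coefficients, so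
    that polynomials can stand for series in bounded degree. *)
Definition agree N (a : fps n) P := forall m, (mdeg m < N)%N -> a m = P@_m.

Lemma agree_mul N a b P Q : agree N a P -> agree N b Q -> agree N (fps_mul a b) (P * Q).
Proof.
move=> aP bQ m mN; rewrite mcoeffM /fps_mul; apply: eq_bigr => -[k1 k2] /= /eqP mE.
have /(congr1 (fun m' : 'X_{1..n} => mdeg m')) := mE; rewrite mdegD => dE.
by rewrite aP ?bQ //; apply: leq_ltn_trans mN; apply: leq_trans (eq_leq (esym dE));
  rewrite ?leq_addr ?leq_addl.
Qed.

Lemma agree_pow N a P k : agree N a P -> agree N (fps_pow a k) (P ^+ k).
Proof.
move=> aP; elim: k => [|k IH]; first by [].
by rewrite exprS /=; apply: agree_mul.
Qed.

Lemma fps_exp_polyE P m :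
  fps_exp (fps_poly P) m = \sum_(k < (mdeg m).+1) (P ^+ k)@_m / k`!%:R.
Proof.
apply: eq_bigr => k _; rewrite (@agree_pow (mdeg m).+1 _ P) //.
Qed.

Lemma agree_exp_linear N c i :
  agree N.+2 (fps_exp (fps_poly (c *: 'X_i))) (in_var i (exp_poly N c)).
Proof.
move=> m mN; rewrite fps_exp_polyE mcoeff_in_var coef_poly.
have mi : (m i <= mdeg m)%N by rewrite mdegE (bigD1 i) //= leq_addr.
rewrite (leq_ltn_trans mi mN).
have E (k : nat) : ((c *: 'X_i) ^+ k)@_m = if m == (U_(i) *+ k)%MM then c ^+ k else 0.
  rewrite exprZn mpolyXn mcoeffZ mcoeffX eq_sym.
  by case: eqP; rewrite ?mulr1 ?mulr0.
under eq_bigr do rewrite E.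
case: eqP => mE; last first.
  rewrite big1 // => k _; case: eqP => [mk|_]; last by rewrite mul0r.
  have /(congr1 (fun m' : 'X_{1..n} => m' i)) := mk; rewrite mulmnE mnm1E eqxx mul1n => ik.
  by case: mE; rewrite ik.
have mi' : (m i < (mdeg m).+1)%N by rewrite ltnS.
rewrite (bigD1 (Ordinal mi')) //= -mE eqxx big1 ?addr0 // => k ki.
case: eqP => [mk|_]; last by rewrite mul0r.
have /(congr1 (fun m' : 'X_{1..n} => m' i)) := mk; rewrite mulmnE mnm1E eqxx mul1n => ik.
by case/eqP: ki; apply: val_inj.
Qed.
End Lift.

(** * The numbers xi *)

(** sinh x / x, as a series in x^2. *)
Definition sinhc_poly N : {poly algC} := \poly_(i < N) ((2 * i).+1)`!%:R^-1.

Lemma mnm1_ord0 (m : 'X_{1..1}) : m = (U_(ord0) *+ m ord0)%MM.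
Proof. by apply/mnmP => i; rewrite ord1 mulmnE mnm1E eqxx mul1n. Qed.

Lemma agree_sinhc N :
  agree (2 * N) sinhx_over_x (in_var (ord0 : 'I_1) (sinhc_poly N \Po 'X^2)).
Proof.
move=> m mN; rewrite mcoeff_in_var -mnm1_ord0 eqxx coef_comp_poly_Xn // /sinhx_over_x /sinh_coef.
rewrite mdegE big_ord1 in mN; rewrite dvdn2 oddS.
case: (boolP (odd (m ord0))) => //= ev.
have mE : m ord0 = (2 * (m ord0 %/ 2))%N by rewrite mulnC divnK ?dvdn2.
by rewrite coef_poly -mE ltn_divLR // mulnC mN.
Qed.

Lemma coef_exp_lt (R : comNzRingType) (g : {poly R}) k j : g`_0 = 0 -> (j < k)%N -> (g ^+ k)`_j = 0.
Proof.
move=> g0 jk; have /factor_theorem[h ->] : root g 0 by rewrite rootE horner_coef0 g0.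
by rewrite subr0 exprMn coefMXn jk.
Qed.

Definition log_sinhc N : {poly algC} :=
  \sum_(1 <= k < N.+2) ((-1) ^+ k.+1 / k%:R) *: (sinhc_poly N.+2 - 1) ^+ k.

(** The powers of sinh x / x - 1 beyond the j-th have no term in x^2j, so that
    the truncations at different orders agree. *)
Lemma xiE N j : (j <= N.+1)%N -> xi j = (log_sinhc N)`_j.
Proof.
move=> jN; set g := sinhc_poly N.+2 - 1.
have g0 : g`_0 = 0 by rewrite coefB coef_poly coef1 /= muln0 factS fact0 invr1 subrr.
have powE k : (1 <= k)%N ->
    fps_pow (fun m' => sinhx_over_x m' - fps_poly 1 m') k (U_(ord0) *+ (2 * j))%MM = (g ^+ k)`_j.
  move=> k1.
  have ag : agree (2 * N.+2) (fun m' => sinhx_over_x m' - fps_poly 1 m')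
      (in_var (ord0 : 'I_1) (g \Po 'X^2)).
    move=> m mN; rewrite (@agree_sinhc N.+2) // /fps_poly mcoeff1 !mcoeff_in_var -mnm1_ord0 eqxx.
    rewrite comp_polyB coefB comp_polyC coef1; congr (_ - _%:R).
    by rewrite {1}[m]mnm1_ord0 -mdeg_eq0 mdegMn mdeg1 mul1n.
  rewrite (agree_pow k ag) ?mdegMn ?mdeg1 ?mul1n; last by rewrite ltn_mul2l /= ltnS.
  rewrite -in_varX mcoeff_in_var mulmnE mnm1E eqxx mul1n eqxx -rmorphXn /=.
  by rewrite coef_comp_poly_Xn // dvdn_mulr // mulKn.
rewrite /xi /fps_log mdegMn mdeg1 mul1n.
transitivity (\sum_(1 <= k < j.+1) (-1) ^+ k.+1 / k%:R * (g ^+ k)`_j).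
  rewrite (@big_cat_nat _ _ _ j.+1 1 (2 * j).+1) //=; last by rewrite ltnS mul2n -addnn leq_addr.
  rewrite [X in _ + X]big1_seq ?addr0 => [|k].
    by apply: eq_big_nat => k /andP[k1 _]; rewrite powE.
  rewrite mem_index_iota => /andP[_ /andP[jk _]].
  by rewrite powE ?(coef_exp_lt g0) ?mulr0 // (leq_trans _ jk).
rewrite coef_sum (@big_cat_nat _ _ _ j.+1 1 N.+2) //=.
rewrite [X in _ = _ + X]big1_seq ?addr0 => [|k].
  by apply: eq_bigr => k _; rewrite coefZ.
by rewrite mem_index_iota => /andP[_ /andP[jk _]]; rewrite coefZ (coef_exp_lt g0) ?mulr0.
Qed.

Lemma is_exp_xi N : is_exp N (\poly_(i < N.+2) xi i) (sinhc_poly N.+2).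
Proof.
apply: is_exp_congr (is_exp_log N _); last by rewrite coef_poly muln0 factS fact0 invr1.
apply/truncP => i iN; rewrite !coef_deriv coef_poly ltnS ltnS iN.
by rewrite -/(log_sinhc N) -xiE.
Qed.

Section PartitionSeries.
Variables (l : nat) (beta : seq nat).

Definition weight j : algC := xi j * S_num beta j.

(** The sum over partitions is a series in (y/2)^2. *)
Definition partition_poly N : {poly algC} :=
  ((\poly_(i < N.+2) partition_sum weight i) \Po (4^-1 *: 'X)) \Po 'X^2.

Lemma agree_partition_series N :
  agree (2 * N.+2) (partition_series l beta) (in_var (yvar l) (partition_poly N)).
Proof.
move=> m mN; rewrite mcoeff_in_var coef_comp_poly_Xn // coef_comp_scaleX coef_poly.
have my : (m (yvar l) <= mdeg m)%N by rewrite mdegE (bigD1 (yvar l)) //= leq_addr.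
rewrite ltn_divLR // (mulnC N.+2) (leq_ltn_trans my mN) /partition_series.
have E k : ((2^-1 *: 'X_(yvar l)) ^+ k)@_m =
    if m == (U_(yvar l) *+ k)%MM then 2^-1 ^+ k else 0 :> algC.
  rewrite exprZn mpolyXn mcoeffZ mcoeffX eq_sym.
  by case: eqP; rewrite ?mulr1 ?mulr0.
under eq_bigr do rewrite E.
have [mE|mE] := eqVneq m (U_(yvar l) *+ m (yvar l))%MM; last first.
  rewrite big1 // => la _; case: eqP => [mk|_]; last by rewrite mulr0.
  by case/eqP: mE; rewrite {2}mk mulmnE mnm1E eqxx mul1n.
have eqE k : (m == (U_(yvar l) *+ k)%MM) = (m (yvar l) == k).
  apply/eqP/eqP => [->|<- //]; by rewrite mulmnE mnm1E eqxx mul1n.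
under eq_bigr do rewrite eqE.
case: ifP => [ev|od]; last first.
  rewrite big1 // => la _; case: eqP => [mk|_]; last by rewrite mulr0.
  by move: od; rewrite mk dvdn_mulr.
set h := (m (yvar l) %/ 2)%N; have hE : m (yvar l) = (2 * h)%N by rewrite mulnC divnK.
transitivity (\sum_(la : partition_le (mdeg m) | sumn la == h)
    4^-1 ^+ h * ((\prod_(j <- parts la) weight j) / (aut_part la)%:R)).
  rewrite [RHS]big_mkcond; apply: eq_bigr => la _; rewrite hE eqn_mul2l /= eq_sym.
  case: eqP => [->|_]; last by rewrite mulr0.
  rewrite mulrC /xi_part /S_part -big_split /= exprM; congr (_ ^+ _ * _).
  by field.
rewrite -mulr_sumr (@big_partition_le _ (mdeg m) h (fun s => (\prod_(j <- s) weight j) / (aut_part s)%:R)) //.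
by rewrite (leq_trans _ my) // hE mul2n -addnn leq_addr.
Qed.
End PartitionSeries.

(** * The factor in y *)

Section YFactor.
Local Notation trunc N := (in_qpoly ('X^(N.+1) : {poly algC})).

Lemma trunc_comp_X2 N p q : trunc N p = trunc N q ->
  trunc (2 * N).+1 (p \Po 'X^2) = trunc (2 * N).+1 (q \Po 'X^2).
Proof.
move=> /truncP E; apply/truncP => i iN; rewrite !coef_comp_poly_Xn //; case: ifP => // ev.
by apply: E; lia.
Qed.

Lemma trunc_comp_scale N (c : algC) p q : trunc N p = trunc N q ->
  trunc N (p \Po (c *: 'X)) = trunc N (q \Po (c *: 'X)).
Proof.
by move=> /truncP E; apply/truncP => i iN; rewrite !coef_comp_scaleX E.
Qed.

Lemma truncM_eq0 N (f D : {poly algC}) : f`_0 != 0 -> trunc N (f * D) = 0 -> trunc N D = 0.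
Proof.
move=> f0; rewrite -[X in _ = X -> _](rmorph0 (trunc N)) => /truncP fD.
rewrite -(rmorph0 (trunc N)); apply/truncP => i; elim/ltn_ind: i => i IH iN.
have := fD i iN; rewrite coefM big_ord_recl big1 ?addr0 => [|k _].
  by rewrite !coef0 subn0 => /eqP; rewrite mulf_eq0 (negbTE f0) => /eqP.
rewrite /= /bump /= add1n IH ?coef0 ?mulr0 //; have := ltn_ord k; lia.
Qed.

Lemma truncMX_eq0 N (D : {poly algC}) : trunc N.+1 ('X * D) = 0 -> trunc N D = 0.
Proof.
rewrite -[X in _ = X -> _](rmorph0 (trunc N.+1)) => /truncP XD.
rewrite -(rmorph0 (trunc N)); apply/truncP => i iN.
by have := XD i.+1 iN; rewrite !coef0 mulrC coefMX.
Qed.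

Variables (N : nat) (beta : seq nat).
Local Notation M := (2 * N.+1).+1.
Local Notation Z := (trunc M).
Local Notation e c := (Z (exp_poly (2 * N.+1) c)).

(** The series of sinh (c X) / (c X). *)
Definition sinhc_at (c : algC) : {poly algC} :=
  (sinhc_poly N.+2 \Po (c ^+ 2 *: 'X)) \Po 'X^2.

Lemma sinhc_atE c : Z ((2 * c)%:P * 'X * sinhc_at c) = e c - e (- c).
Proof.
rewrite -rmorphB; apply/truncP => i iM.
rewrite -mulrA coefCM ['X * _]mulrC coefMX coefB !coef_poly ltnS iM.
case: i iM => [|i] iM /=; first by rewrite !expr0 subrr mulr0.
rewrite coef_comp_poly_Xn // coef_comp_scaleX coef_poly.
rewrite exprNn -mulrBl -signr_odd /= dvdn2.
case: (boolP (odd i)) => od /=; first by rewrite expr0 mul1r subrr mul0r mulr0.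
have iE : (2 * (i %/ 2))%N = i by rewrite mulnC divnK // dvdn2.
rewrite iE ltn_divLR // (mulnC N.+2) (_ : (i < 2 * N.+2)%N); last by lia.
by rewrite -exprM iE exprS; ring.
Qed.

(** As S_2j + 1 is the power sum of degree 2j of the parts, the logarithms of the
    two sides are the same combination of the xi_2j. *)
Lemma partition_poly_sinhc :
  Z (partition_poly beta N * sinhc_at 2^-1) = Z (\prod_(k <- beta) sinhc_at (k%:R / 2)).
Proof.
pose A := \poly_(i < N.+2) weight beta i; pose L := \poly_(i < N.+2) xi i.
pose PP := \poly_(i < N.+2) partition_sum (weight beta) i; pose r := sinhc_poly N.+2.
(* L is the logarithm of sinhc; adding it removes the -1 from S. *)
have AE : A + L = \sum_(k <- beta) (L \Po ((k%:R ^+ 2) *: 'X)).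
  apply/polyP => i; rewrite coefD !coef_poly coef_sum.
  under eq_bigr do rewrite coef_comp_scaleX coef_poly.
  case: ifP => iN; last by rewrite addr0 big1 // => k _; rewrite mulr0.
  rewrite /weight /S_num mulrDr mulrN1 addrAC addNr add0r mulr_sumr.
  by apply: eq_bigr => k _; rewrite mulrC exprM.
have E1 : is_exp N (A + L) (PP * r) by apply: is_expM; [apply: is_exp_partition_sum | apply: is_exp_xi].
have E2 : is_exp N (A + L) (\prod_(k <- beta) (r \Po ((k%:R ^+ 2) *: 'X))).
  by rewrite AE; apply: is_exp_prod => k; apply: is_exp_scale; apply: is_exp_xi.
have /(trunc_comp_scale 4^-1)/trunc_comp_X2 := is_exp_uniq E1 E2.
rewrite !comp_polyM !rmorph_prod /= => E.
have sE c c' : c' ^+ 2 = c * 4^-1 -> ((r \Po (c *: 'X)) \Po (4^-1 *: 'X)) \Po 'X^2 = sinhc_at c'.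
  move=> cc; rewrite /sinhc_at cc; congr (_ \Po _); apply/polyP => i.
  by rewrite !coef_comp_scaleX exprMn mulrA; congr (_ * _); rewrite mulrC.
rewrite /partition_poly -/PP.
have <- : (r \Po (4^-1 *: 'X)) \Po 'X^2 = sinhc_at 2^-1.
  by rewrite /sinhc_at -/r; congr (_ \Po (_ *: _) \Po _); field.
rewrite E; apply: eq_bigr => k _.
by congr (Z _); apply: sE; field.
Qed.

Lemma prod_sinhc_exp (s : seq nat) :
  Z ((\prod_(k <- s) k)%N%:R%:P * (exp_poly (2 * N.+1) (- (sumn s)%:R / 2) * 'X^(size s)
       * \prod_(k <- s) sinhc_at (k%:R / 2)))
  = \prod_(k <- s) (1 - e (- k%:R)).
Proof.
elim: s => [|k s IH].
  by rewrite !big_nil /= oppr0 mul0r exp_poly0 expr0 !mulr1 rmorph1.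
rewrite !big_cons -IH /=; set P := \prod_(j <- s) sinhc_at _; set b := (\prod_(j <- s) j)%N.
have -> : 1 - e (- k%:R) = e (- (k%:R / 2)) * (e (k%:R / 2) - e (- (k%:R / 2))).
  rewrite mulrBr -!rmorphM /= -!exp_polyD addNr exp_poly0 rmorph1; congr (_ - e _).
  by field.
rewrite -sinhc_atE (_ : - (k + sumn s)%:R / 2 = - (k%:R / 2) + - (sumn s)%:R / 2); last first.
  by rewrite natrD; field.
have -> : 2 * (k%:R / 2) = k%:R :> algC by field.
have eD := exp_polyD (2 * N.+1) (- (k%:R / 2)) (- (sumn s)%:R / 2).
rewrite natrM polyCM (exprS 'X (size s)) !rmorphM /= eD !rmorphM /=.
by ring.
Qed.

(** Multiplying by X sinhc (X / 2), that is by exp (X/2) - exp (-X/2), turns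
    both sides into the product of the 1 - exp (-k X) over the parts k. *)
Lemma y_factorE (a : nat -> algC) d t : beta != [::] -> sumn beta = d ->
    (1 - 'X) * (\sum_(j < d) a j *: 'X^j) = \prod_(k <- beta) (1 - 'X^k) :> {poly algC} ->
    (t <= 2 * N.+1)%N ->
  (\prod_(k <- beta) k)%N%:R *
    (exp_poly (2 * N.+1) (- (d%:R / 2)) * 'X^((size beta).-1) * partition_poly beta N)`_t =
  \sum_(j < d) a j * ((- j%:R - 2^-1) ^+ t / t`!%:R).
Proof.
move=> beta0 bd aE tN; set b := (\prod_(k <- beta) k)%N.
pose L := b%:R%:P * (exp_poly (2 * N.+1) (- (d%:R / 2)) * 'X^((size beta).-1) * partition_poly beta N).
pose W := \sum_(j < d) a j *: exp_poly (2 * N.+1) (- j%:R - 2^-1).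
suff /truncP/(_ t tN) : trunc (2 * N.+1) L = trunc (2 * N.+1) W.
  rewrite coefCM coef_sum => ->; apply: eq_bigr => j _.
  by rewrite coefZ coef_poly !ltnS (leq_trans tN).
have expX k : e (- k%:R) = e (- 1) ^+ k.
  elim: k => [|k IH]; first by rewrite oppr0 exp_poly0 rmorph1 expr0.
  by rewrite (exprS (e (- 1)) k) -IH -natr1 opprD addrC exp_polyD rmorphM.
have LE : Z ('X * (sinhc_at 2^-1 * L)) = \prod_(k <- beta) (1 - e (- k%:R)).
  rewrite -prod_sinhc_exp -/b bd (rmorphM Z 'X) /= [sinhc_at _ * L]mulrC.
  have -> : L * sinhc_at 2^-1 = b%:R%:P * (exp_poly (2 * N.+1) (- (d%:R / 2)) * 'X^((size beta).-1))
     * (partition_poly beta N * sinhc_at 2^-1) by rewrite /L -!mulrA.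
  rewrite (rmorphM Z (_ * _) (_ * sinhc_at _)) /= partition_poly_sinhc.
  set P := \prod_(k <- beta) _; set C := b%:R%:P * (exp_poly _ _ * 'X^((size beta).-1)).
  rewrite -(rmorphM Z C P) -(rmorphM Z 'X (C * P)); congr (Z _).
  rewrite /C; have -> : 'X^(size beta) = 'X * 'X^((size beta).-1) :> {poly algC}.
    by rewrite -exprS prednK // lt0n size_eq0.
  by rewrite mulNr; move: ('X^((size beta).-1)) (b%:R%:P) => Y B; ring.
have WE : Z ('X * (sinhc_at 2^-1 * W)) = \prod_(k <- beta) (1 - e (- k%:R)).
  have := sinhc_atE 2^-1; rewrite mulfV ?pnatr_eq0 // mul1r rmorphM /= => sE.
  rewrite mulrA (mulrC (_ * _) W) rmorphM (rmorphM _ 'X) /= sE.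
  transitivity (Z (((1 - 'X) * (\sum_(j < d) a j *: 'X^j)) \Po exp_poly (2 * N.+1) (- 1))).
    rewrite comp_polyM comp_polyB comp_polyC comp_polyX [RHS]rmorphM rmorphB rmorph1 /= [RHS]mulrC.
    rewrite /W !raddf_sum /= !mulr_suml; apply: eq_bigr => j _.
    rewrite comp_polyZ comp_Xn_poly -!mul_polyC !rmorphM /= rmorphXn /= -expX.
    have eM x y : e (x + y) = e x * e y by rewrite exp_polyD rmorphM.
    have -> : e (- 1) = e (- 2^-1) * e (- 2^-1) by rewrite -eM; congr (e _); field.
    have half : e 2^-1 * e (- 2^-1) = 1 by rewrite -eM subrr exp_poly0 rmorph1.
    rewrite eM.
    rewrite [LHS](_ : _ = Z (a j)%:P * e (- j%:R) * (e 2^-1 * e (- 2^-1) - e (- 2^-1) * e (- 2^-1))); last by ring.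
    by rewrite half; ring.
  rewrite aE rmorph_prod rmorph_prod; apply: eq_bigr => k _ /=.
  by rewrite comp_polyB comp_polyC comp_Xn_poly rmorphB rmorph1 rmorphXn /= expX.
(* The factor X is cancelled at the cost of one degree, sinhc at none. *)
have D0 : Z ('X * (sinhc_at 2^-1 * (L - W))) = 0.
  by rewrite !mulrBr rmorphB /= LE WE subrr.
have s0 : (sinhc_at 2^-1)`_0 != 0.
  by rewrite coef_comp_poly_Xn // dvdn0 div0n coef_comp_scaleX expr0 mul1r coef_poly muln0 invr1 oner_eq0.
have := truncM_eq0 s0 (truncMX_eq0 D0); rewrite rmorphB => /eqP; rewrite subr_eq0 => /eqP.
by [].
Qed.
End YFactor.

(** * The factor in t and z *)

Section TZFactor.
Variable l : nat.
Implicit Type m : 'X_{1..(l + 2)}.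

Definition diff_pow (i : nat) : {poly algC} := (1 + 'X) ^+ i - 'X ^+ i.

Definition U_exponent : {mpoly algC[l + 2]} :=
  \sum_(i < l) in_var (zvar l) (diff_pow i.+1) * 'X_(tvar i).

Lemma U_exponentE :
  \sum_(i < l) ((1 + 'X_(zvar l)) ^+ i.+1 - 'X_(zvar l) ^+ i.+1) * 'X_(tvar i) = U_exponent.
Proof.
apply: eq_bigr => i _; congr (_ * _).
by rewrite /in_var /diff_pow rmorphB !rmorphXn rmorphD rmorph1 /= map_polyX !hornerE.
Qed.

Definition tz_poly m : {poly algC} :=
  \prod_(i < l) ((m (tvar i))`!%:R^-1 *: diff_pow i.+1 ^+ m (tvar i)).

Lemma tvar_neq (i : 'I_l) : ((tvar i == zvar l) = false) * ((tvar i == yvar l) = false).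
Proof. by rewrite !eq_lrshift. Qed.

Lemma zyvar_neq : ((zvar l == yvar l) = false) * ((yvar l == zvar l) = false).
Proof. by rewrite !eq_rshift. Qed.

Lemma mnm_eq_vars m m' : (forall i : 'I_l, m (tvar i) = m' (tvar i)) ->
  m (zvar l) = m' (zvar l) -> m (yvar l) = m' (yvar l) -> m = m'.
Proof.
move=> et ez ey; apply/mnmP => i; case: (split_ordP i) => j ->; first exact: et.
have [->|j1] := eqVneq j ord0; first exact: ez.
by rewrite (_ : j = ord_max) ?ey //; apply/val_inj; case: j j1 => [[|[|]]].
Qed.

(** Multinomial theorem in the variables t, one factor at a time. *)
Lemma mcoeff_U_exponent_pow k m :
  (U_exponent ^+ k)@_m =
    if (\sum_(i < l) m (tvar i) == k)%N && (m (yvar l) == 0%N)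
    then k`!%:R * (tz_poly m)`_(m (zvar l)) else 0.
Proof.
elim: k m => [|k IH] m.
  rewrite expr0 mcoeff1 fact0 mul1r sum_nat_eq0.
  case: ifP => [/andP[/forallP t0 /eqP y0]|H].
    have -> : tz_poly m = 1.
      by rewrite /tz_poly big1 // => i _; have /eqP -> := t0 i; rewrite expr0 fact0 invr1 scale1r.
    rewrite coef1; congr (nat_of_bool _)%:R; apply/eqP/eqP => [->|z0]; first by rewrite mnm0E.
    by apply: mnm_eq_vars => [i||]; rewrite mnm0E //; apply/eqP; apply: (t0 i).
  case: eqP => // m0; case/negP: (negbT H); rewrite m0 mnm0E eqxx andbT.
  by apply/forallP => i; rewrite mnm0E.
rewrite exprSr {2}/U_exponent mulr_sumr raddf_sum /=.
pose ok := (\sum_(i < l) m (tvar i) == k.+1)%N && (m (yvar l) == 0%N).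
transitivity (\sum_(i < l) if ok then k`!%:R * ((m (tvar i))%:R * (tz_poly m)`_(m (zvar l))) else 0).
  apply: eq_bigr => i _; rewrite mulrA -['X_(tvar i)]expr1 mcoeffMXn mulm1n.
  case: ltnP => [mi|mi]; last first.
    have mt0 : m (tvar i) = 0%N by apply/eqP; rewrite -leqn0 -ltnS.
    by rewrite mt0 mul0r mulr0 if_same.
  rewrite mcoeff_in_varM; set m1 := (m - U_(tvar i))%MM.
  have m1z : m1 (zvar l) = m (zvar l) by rewrite mnmBE mnm1E (tvar_neq i) subn0.
  have m1y : m1 (yvar l) = m (yvar l) by rewrite mnmBE mnm1E (tvar_neq i) subn0.
  have m1t i' : m1 (tvar i') = (m (tvar i') - (i == i'))%N.
    by rewrite mnmBE mnm1E eq_lshift.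
  have sumE : (\sum_(i' < l) m (tvar i') = (\sum_(i' < l) m1 (tvar i')).+1)%N.
    rewrite (bigD1 i) //= [in RHS](bigD1 i) //= m1t eqxx -addSn subn1 prednK //; congr (_ + _)%N.
    by apply: eq_bigr => i' /negbTE; rewrite eq_sym m1t => ->; rewrite subn0.
  have m2t j i' : (m1 - U_(zvar l) *+ j)%MM (tvar i') = m1 (tvar i').
    by rewrite mnmBE mulmnE mnm1E eq_sym (tvar_neq i') mul0n subn0.
  have m2y j : (m1 - U_(zvar l) *+ j)%MM (yvar l) = m1 (yvar l).
    by rewrite mnmBE mulmnE mnm1E zyvar_neq mul0n subn0.
  have m2z j : (m1 - U_(zvar l) *+ j)%MM (zvar l) = (m (zvar l) - j)%N.
    by rewrite mnmBE mulmnE mnm1E eqxx mul1n m1z.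
  have tz2 j : tz_poly (m1 - U_(zvar l) *+ j)%MM = tz_poly m1.
    by apply: eq_bigr => i' _; rewrite m2t.
  have tzE : tz_poly m1 * diff_pow i.+1 = (m (tvar i))%:R *: tz_poly m.
    rewrite /tz_poly (bigD1 i) //= [in RHS](bigD1 i) //= m1t eqxx subn1.
    rewrite (eq_bigr (fun i' : 'I_l => (m (tvar i'))`!%:R^-1 *: diff_pow i'.+1 ^+ m (tvar i'))); last first.
      by move=> i' /negbTE; rewrite eq_sym m1t => ->; rewrite subn0.
    have [g gE] : exists g, m (tvar i) = g.+1 by exists (m (tvar i)).-1; rewrite prednK.
    rewrite gE /= -!scalerAl scalerA factS natrM invfM mulrA mulfV ?pnatr_eq0 // mul1r.
    by rewrite exprSr mulrAC.
  rewrite (eq_bigr (fun j : 'I__ => if ok then k`!%:R * ((tz_poly m1)`_(m (zvar l) - j) * (diff_pow i.+1)`_j) else 0)).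
    case: ifP => okE; last by rewrite big1.
    rewrite -mulr_sumr m1z -coefMr tzE coefZ; congr (_ * _).
  move=> j _; rewrite IH m2y m1y m2z tz2 /ok sumE eqSS.
  under eq_bigr do rewrite m2t.
  by case: ifP => _; rewrite ?mul0r // mulrA.
rewrite -/ok; case: ifP => okE; last by rewrite big1.
rewrite -mulr_sumr -mulr_suml -natr_sum; have /andP[/eqP -> _] := okE.
by rewrite factS natrM; ring.
Qed.

Lemma agree_U_series N :
  agree N (U_series l) (\sum_(k < N) k`!%:R^-1 *: U_exponent ^+ k).
Proof.
move=> m mN; rewrite /U_series U_exponentE fps_exp_polyE raddf_sum /=.
rewrite (big_ord_widen_cond N xpredT (fun k => (U_exponent ^+ k)@_m / k`!%:R)) // big_mkcond /=.
apply: eq_bigr => k _; rewrite mcoeffZ [RHS]mulrC; case: (ltnP k (mdeg m).+1) => // km.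
rewrite mcoeff_U_exponent_pow ifF ?mul0r //; apply/negbTE; rewrite negb_and; apply/orP; left.
rewrite neq_ltn; apply/orP; left; apply: leq_ltn_trans km.
by rewrite mdegE big_split_ord leq_addr.
Qed.

Lemma in_varXn n (i : 'I_n) k : in_var i 'X^k = 'X_i ^+ k.
Proof. by rewrite in_varX /in_var map_polyX hornerX. Qed.

Variable b : nat -> nat.

Lemma rhs_monomialE t :
  ((forall i : 'I_l, rhs_monomial l b t (tvar i) = b i.+1) *
   (rhs_monomial l b t (zvar l) = t) * (rhs_monomial l b t (yvar l) = t))%type.
Proof.
rewrite /rhs_monomial; split; first split => [i|].
- rewrite !mnmDE !mulmnE !mnm1E mnm_sumE (bigD1 i) //= mulmnE mnm1E eqxx mul1n.
  rewrite ![_ == tvar i]eq_sym !(tvar_neq i) !addn0 big1 ?addn0 // => j ji.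
  by rewrite mulmnE mnm1E eq_lshift (negbTE ji).
- rewrite !mnmDE !mulmnE !mnm1E mnm_sumE zyvar_neq eqxx mul1n addn0 big1 // => j _.
  by rewrite mulmnE mnm1E (tvar_neq j).
- rewrite !mnmDE !mulmnE !mnm1E mnm_sumE zyvar_neq eqxx mul1n addn0 big1 // => j _.
  by rewrite mulmnE mnm1E (tvar_neq j).
Qed.

(** Only the t- and z-variables occur in the first factor and only y in the
    others, so the coefficient splits. *)
Lemma rhs_coefE d beta t (N := mdeg (rhs_monomial l b t)) :
  rhs_series l d beta (rhs_monomial l b t) =
  (\prod_(i < l) ((b i.+1)`!%:R^-1 *: diff_pow i.+1 ^+ b i.+1))`_t *
  (exp_poly (2 * N.+1) (- (d%:R / 2)) * 'X^((size beta).-1) * partition_poly beta N)`_t.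
Proof.
set m := rhs_monomial l b t.
have ag : agree (2 * N.+2) (rhs_series l d beta)
   ((\sum_(k < 2 * N.+2) k`!%:R^-1 *: U_exponent ^+ k) *
    in_var (yvar l) (exp_poly (2 * N.+1) (- (d%:R / 2)) * 'X^((size beta).-1) * partition_poly beta N)).
  rewrite !in_varM !mulrA; apply: agree_mul (@agree_partition_series l beta N).
  rewrite in_varXn; apply: agree_mul; last by [].
  apply: agree_mul; first exact: agree_U_series.
  have -> : (2 * N.+2 = (2 * N.+1).+2)%N by rewrite !mul2n.
  exact: agree_exp_linear.
rewrite ag; last by rewrite mul2n -addnn ltn_addr.
have [[mt mz] my] := rhs_monomialE t.
rewrite mcoeff_in_varM my big_ord_recr /= big1 ?add0r => [|j _]; last first.
  rewrite raddf_sum /= big1 ?mul0r // => k _.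
  rewrite mcoeffZ mcoeff_U_exponent_pow ifF ?mulr0 // mnmBE mulmnE mnm1E eqxx mul1n my.
  by rewrite subn_eq0 leqNgt ltn_ord andbF.
congr (_ * _).
have m't i : (m - U_(yvar l) *+ t)%MM (tvar i) = b i.+1.
  by rewrite mnmBE mulmnE mnm1E eq_sym (tvar_neq i) mul0n subn0 mt.
have m'y : (m - U_(yvar l) *+ t)%MM (yvar l) = 0%N.
  by rewrite mnmBE mulmnE mnm1E eqxx mul1n my subnn.
have m'z : (m - U_(yvar l) *+ t)%MM (zvar l) = t.
  by rewrite mnmBE mulmnE mnm1E zyvar_neq mul0n subn0 mz.
have tzE : tz_poly (m - U_(yvar l) *+ t)%MM = \prod_(i < l) ((b i.+1)`!%:R^-1 *: diff_pow i.+1 ^+ b i.+1).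
  by apply: eq_bigr => i _; rewrite m't.
have sb : (\sum_(i < l) (m - U_(yvar l) *+ t)%MM (tvar i) < 2 * N.+2)%N.
  under eq_bigr do rewrite m't -mt; rewrite mul2n -addnn ltn_addr //.
  by rewrite ltnS (leq_trans _ (leqnSn _)) // /N mdegE big_split_ord leq_addr.
rewrite raddf_sum /= (bigD1 (Ordinal sb)) //= [X in _ + X]big1 ?addr0 => [|k kb].
  rewrite mcoeffZ mcoeff_U_exponent_pow eqxx m'y m'z tzE /= mulrA mulVf ?mul1r //.
  by rewrite pnatr_eq0 -lt0n fact_gt0.
rewrite mcoeffZ mcoeff_U_exponent_pow ifF ?mulr0 //.
by apply: contraNF kb => /andP[/eqP kE _]; apply/eqP/val_inj.
Qed.
End TZFactor.

(** * Conclusion *)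

Lemma prod_by_multiplicity (R : comNzSemiRingType) (F : nat -> R) (K : seq nat) l :
    all (leq 1) K -> (forall k, k \in K -> (k <= l)%N) ->
  \prod_(k <- K) F k = \prod_(i < l) F i.+1 ^+ count_mem i.+1 K.
Proof.
elim: K => [|k K IH] /=; first by rewrite big_nil big1.
move=> /andP[k1 K1] Kl; rewrite big_cons IH // => [|j jK]; last by rewrite Kl // inE jK orbT.
have kl : (k.-1 < l)%N by rewrite prednK // Kl // mem_head.
rewrite [RHS](eq_bigr (fun i : 'I_l => F i.+1 ^+ (k == i.+1) * F i.+1 ^+ count_mem i.+1 K)); last first.
  by move=> i _; rewrite /= exprD.
rewrite big_split /=; congr (_ * _); rewrite (bigD1 (Ordinal kl)) //= prednK // eqxx expr1.
rewrite big1 ?mulr1 // => i; rewrite -val_eqE /= => ik.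
rewrite (_ : (k == i.+1) = false) ?expr0 //; apply: contraNF ik => /eqP ->.
by [].
Qed.

Lemma signed_hook_value_gen d beta : (0 < d)%N -> is_partition beta -> sumn beta = d ->
  (1 - 'X) * (\sum_(j < d) signed_hook_value beta j *: 'X^j) = \prod_(k <- beta) (1 - 'X^k) :> {poly algC}.
Proof.
move=> d0 bp bd; have [s sb] := conj_class_ex bp bd.
have sE : perm_eq (cycle_lengths s) beta by move: sb; rewrite inE cycle_typeE.
rewrite -(perm_big _ sE) -(hook_cfun_gen s d0); congr (_ * _); apply: eq_bigr => j _.
rewrite hook_cfun_coef //; congr (_ *: _); apply: eq_bigr => i _.
by rewrite (perm_big _ sE).
Qed.

Theorem corollary4p2
  (kappa : nat -> seq nat -> algC) (kappaP : p_expansion kappa)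
  (K : seq nat) (K_neq0 : K != [::]) (K_pos : all (leq 1) K)
  (l : nat) (lE : l = \max_(k <- K) k)
  (b : nat -> nat) (bE : forall i : nat, b i = count_mem i K)
  (d : nat) (d_gt0 : (0 < d)%N)
  (beta : seq nat) (beta_part : is_partition beta) (beta_d : sumn beta = d) :
  exists2 v : algC,
    has_finite_sum
      (fun t => t`!%:R / d%:R ^+ t * rhs_series l d beta (rhs_monomial l b t))
      v &
    hurwitz_m kappa d d K [:: [:: d]; beta] =
      d%:R ^+ (sumn K).-1 / (aut_part beta)%:R
      * (\prod_(1 <= i < l.+1) ((b i)`!%:R / (i`!)%:R ^+ b i))
      * v.
Proof.
pose a := signed_hook_value beta; pose w (j : nat) : algC := (- j%:R - 2^-1) / d%:R.
pose G : {poly algC} := \prod_(i < l) ((b i.+1)`!%:R^-1 *: diff_pow i.+1 ^+ b i.+1).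
have dn0 : d%:R != 0 :> algC by rewrite pnatr_eq0 -lt0n.
have pb0 : (0 < \prod_(k <- beta) k)%N.
  rewrite big_seq; apply: prodn_cond_gt0 => k kb; rewrite lt0n.
  by apply: contraTneq kb => ->; case/andP: beta_part.
have pbn0 : (\prod_(k <- beta) k)%N%:R != 0 :> algC by rewrite pnatr_eq0 -lt0n.
have beta0 : beta != [::] by apply: contraTneq d_gt0 => b0; rewrite -beta_d b0.
exists ((\prod_(k <- beta) k)%N%:R^-1 * \sum_(j < d) a j * G.[w j]).
  exists (size G) => M GM.
  transitivity (\sum_(t < M) (\prod_(k <- beta) k)%N%:R^-1 * \sum_(j < d) a j * (G`_t * w j ^+ t)).
    apply: eq_bigr => t _; rewrite rhs_coefE -/G; set N := mdeg _.
    have tN : (t <= 2 * N.+1)%N.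
      have : (t <= N)%N by rewrite /N mdegE (bigD1 (zvar l)) //= rhs_monomialE leq_addr.
      by move/leq_trans; apply; lia.
    have := y_factorE beta0 beta_d (signed_hook_value_gen d_gt0 beta_part beta_d) tN.
    move/(canRL (mulKf pbn0)) => ->.
    set c := (\prod_(k <- beta) k)%N%:R^-1; set S := \sum_(j < d) _ * (_ / _).
    transitivity (c * (t`!%:R / d%:R ^+ t * G`_t * S)); first by rewrite -!mulrA; move: (_ ^+ _)^-1 => D; ring.
    congr (_ * _); rewrite mulr_sumr; apply: eq_bigr => j _; rewrite /w expr_div_n.
    have f0 : t`!%:R != 0 :> algC by rewrite pnatr_eq0 -lt0n fact_gt0.
    have D0 : d%:R ^+ t != 0 :> algC by rewrite expf_neq0.
    move: (t`!%:R) (d%:R ^+ t) ((- j%:R - 2^-1) ^+ t) f0 D0 => f D u f0 D0.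
    rewrite /a; by field; rewrite f0 D0.
  rewrite -mulr_sumr exchange_big /=; congr (_ * _); apply: eq_bigr => j _.
  by rewrite -mulr_sumr -horner_coef_wide.
rewrite (hurwitz_hook_sum kappaP K_pos d_gt0 beta_part beta_d) -/a /z_part natrM.
have aut0 : (aut_part beta)%:R != 0 :> algC by rewrite pnatr_eq0 -lt0n aut_part_gt0.
set pb := (\prod_(k <- beta) k)%N%:R in pbn0 *.
set D := \prod_(1 <= i < l.+1) _.
transitivity ((d%:R * (aut_part beta)%:R * pb)^-1 * (d%:R ^+ sumn K * D * \sum_(j < d) a j * G.[w j])); last first.
  have [s sE] : exists s, sumn K = s.+1.
    by case: (K) K_neq0 K_pos => // -[|k] K' _ //= _; exists (k + sumn K')%N.
  by rewrite sE exprS /=; field; rewrite dn0 aut0 pbn0.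
rewrite mulrA; congr (_ * _); rewrite mulr_sumr; apply: eq_bigr => j _; rewrite mulrCA; congr (_ * _).
rewrite (@prod_by_multiplicity _ _ K l K_pos) => [|k kK]; last by rewrite lE; apply: leq_bigmax_seq.
(* The power of d is spread over the parts of K, to turn P_k into P_k / d^k. *)
have -> : d%:R ^+ sumn K = \prod_(i < l) (d%:R ^+ i.+1) ^+ b i.+1 :> algC.
  rewrite -(eq_bigr _ (fun i _ => congr1 _ (esym (bE _)))).
  rewrite -(@prod_by_multiplicity _ (fun k => d%:R ^+ k) K l K_pos) => [|k kK]; last by rewrite lE; apply: leq_bigmax_seq.
  by rewrite -expr_sum sumnE.
rewrite /D big_add1 big_mkord /G horner_prod -!big_split /=; apply: eq_bigr => i _.
rewrite hornerZ horner_exp -bE /diff_pow !(hornerE, horner_exp) /w.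
set c := - j%:R - 2^-1.
have -> : 1 + c / d%:R = (d%:R - j%:R - 2^-1) / d%:R by rewrite /c; field.
rewrite !expr_div_n -mulrBl !expr_div_n.
have f0 k : k`!%:R != 0 :> algC by rewrite pnatr_eq0 -lt0n fact_gt0.
have F0 : i.+1`!%:R ^+ b i.+1 != 0 :> algC by rewrite expf_neq0.
have D0 : (d%:R ^+ i.+1) ^+ b i.+1 != 0 :> algC by rewrite !expf_neq0.
move: (i.+1`!%:R ^+ b i.+1) ((d%:R ^+ i.+1) ^+ b i.+1) ((b i.+1)`!%:R) F0 D0 (f0 (b i.+1)).
move: (_ ^+ b i.+1) => Q F D' B F0 D0 B0.
by rewrite /=; field; rewrite F0 D0 B0.
Qed.
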